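(* Let $k\ge 1$, $\lambda_1,\dots,\lambda_k>0$, $\Lambda=\lambda_1+\cdots+\lambda_k$ and $0<\beta<1$. Let $\{M^{\beta}(t)\}_{t\ge0}$ be the generalized fractional counting process with rates $\lambda_1,\dots,\lambda_k$. Then for every $n\ge 0$ and $t>0$ its pmf $p^{\beta}(n,t)=\Pr\{M^{\beta}(t)=n\}$ is given by $$p^{\beta}(n,t)=\sum_{\Omega(k,n)}\left(\prod_{j=1}^{k}\frac{\lambda_{j}^{x_{j}}}{x_{j}!}\right)\frac{1}{\Lambda^{z_{k}}}\,\frac{\mathrm{d}^{z_{k}}}{\mathrm{d}s^{z_{k}}}\left[s^{z_{k}-1}E_{\beta,1}\left(-\frac{\Lambda t^{\beta}}{s}\right)\right]_{s=1},$$ where $z_{k}=x_{1}+x_{2}+\cdots+x_{k}$.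
   Context: Generalized counting process (GCP): the Lévy process $\{M(t)\}_{t\ge0}$ with values in the non-negative integers, $M(0)=0$, whose jumps have amplitudes $1,\dots,k$ occurring at rates $\lambda_1,\dots,\lambda_k$, i.e. $\Pr\{M(t+h)=m+j\mid M(t)=m\}=\lambda_j h+o(h)$ for $1\le j\le k$, $=1-\Lambda h+o(h)$ for $j=0$, and $o(h)$ for $j>k$. Equivalently $M(t)\stackrel{d}{=}\sum_{i=1}^{N(t)}X_i$ with $N$ a Poisson process of rate $\Lambda$ independent of the iid $X_i$, $\Pr\{X_1=j\}=\lambda_j/\Lambda$. Inverse stable subordinator: $Y_\beta(t)=\inf\{x\ge0: D_\beta(x)>t\}$, where $D_\beta$ is the stable subordinator with $\mathbb{E}(e^{-sD_\beta(t)})=e^{-ts^\beta}$. Generalized fractional counting process (GFCP): $M^\beta(t)=M(Y_\beta(t))$ with $M$ and $Y_\beta$ independent. $\Omega(k,n)=\{(x_1,\dots,x_k): x_j\in\{0,1,2,\dots\},\ \sum_{j=1}^k jx_j=n\}$; the sum is over $(x_1,\dots,x_k)\in\Omega(k,n)$. Mittag-Leffler function: $E_{\alpha,\gamma}(x)=\sum_{j=0}^\infty \frac{x^j}{\Gamma(j\alpha+\gamma)}$. *)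

(* Defs.v *)
From HB Require Import structures.
From mathcomp Require Import all_boot all_order all_algebra.
From mathcomp Require Import all_classical all_reals all_analysis.

Set Implicit Arguments.
Unset Strict Implicit.
Unset Printing Implicit Defensive.

Import Order.TTheory GRing.Theory Num.Theory.
Import numFieldNormedType.Exports.

Local Open Scope classical_set_scope.
Local Open Scope ring_scope.

Section special_functions.
Context {R : realType}.

Definition Gamma (a : R) : R :=
  \int[lebesgue_measure]_(x in `]0, +oo[) (x `^ (a - 1) * expR (- x)).

Definition mittag_leffler (alpha gamma x : R) : R :=
  limn [series x ^+ j / Gamma (j%:R * alpha + gamma)]_j.

End special_functions.

(* Coordinates are numbered from 0, so x_j of the mathematical text is
   x (j - 1) and carries the weight j. *)
Definition Omega (k n : nat) : set {ffun 'I_k -> nat} :=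
  [set x | (\sum_(j < k) j.+1 * x j)%N = n].
Arguments Omega : clear implicits.

(* Processes are indexed by all of R, but only times t >= 0 are ever
   constrained. *)
Section processes.
Context {d : measure_display} {T : measurableType d} {R : realType}.
Variable P : probability T R.

Definition cond_prob (A B : set T) : R := fine (P (A `&` B)) / fine (P B).

(* Choosing some A i := setT gives the product rule for subfamilies. *)
Definition independent_rvs (n : nat) (X : 'I_n -> T -> R) : Prop :=
  forall A : 'I_n -> set R, (forall i, measurable (A i)) ->
    (P (\bigcap_i (X i @^-1` A i)) = \prod_(i < n) P (X i @^-1` A i))%E.

Definition sigma_process (X : R -> T -> R) : set (set T) :=
  <<s [set E | exists t (A : set R),
         [/\ 0 <= t, measurable A & E = X t @^-1` A]] >>.

Definition independent_processes (X Y : R -> T -> R) : Prop :=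
  forall A B, sigma_process X A -> sigma_process Y B ->
    (P (A `&` B) = P A * P B)%E.

(* Stochastic continuity follows from right-continuity of the paths and
   stationarity of the increments. Path properties hold for every outcome, so
   that randomly time-changed processes are measurable without completing P. *)
Record levy_process (X : R -> T -> R) : Prop := LevyProcess {
  levy_measurable : forall t, 0 <= t -> measurable_fun setT (X t) ;
  levy_start : forall w, X 0 w = 0 ;
  levy_independent : forall (n : nat) (t : nat -> R),
    0 <= t 0%N -> nondecreasing_seq t ->
    independent_rvs (fun (i : 'I_n) w => X (t i.+1) w - X (t i) w) ;
  levy_stationary : forall (s h : R) (A : set R),
    0 <= s -> 0 <= h -> measurable A ->
    P [set w | A (X (s + h) w - X s w)] = P [set w | A (X h w)] ;
  levy_right_continuous : forall t w, 0 <= t ->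
    X s w @[s --> t^'+] --> X t w ;
  levy_left_limits : forall t w, 0 < t -> cvg (X s w @[s --> t^'-])
}.

Definition nat_process (M : R -> T -> nat) : R -> T -> R :=
  fun t w => (M t w)%:R.

(* Pr{M(t + h) = m + j | M(t) = m} *)
Definition transition_prob (M : R -> T -> nat) (t : R) (m j : nat) (h : R) : R :=
  cond_prob [set w | M (t + h) w = (m + j)%N] [set w | M t w = m].

(* The jump amplitude attached to lambda j, for j : 'I_k, is j.+1. The
   conditional probabilities only make sense when Pr{M(t) = m} > 0. *)
Record generalized_counting_process (k : nat) (lambda : 'I_k -> R)
    (M : R -> T -> nat) : Prop := GeneralizedCountingProcess {
  gcp_levy : levy_process (nat_process M) ;
  gcp_jump : forall t m, 0 <= t -> (0 < P [set w | M t w = m])%E ->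
    forall j : 'I_k,
      transition_prob M t m j.+1 = (fun h => lambda j * h) +o_ (0^'+) id ;
  gcp_nojump : forall t m, 0 <= t -> (0 < P [set w | M t w = m])%E ->
    transition_prob M t m 0 =
      (fun h => 1 - (\sum_(j < k) lambda j) * h) +o_ (0^'+) id ;
  gcp_other : forall t m, 0 <= t -> (0 < P [set w | M t w = m])%E ->
    forall j, (k < j)%N -> transition_prob M t m j =o_ (0^'+) id
}.

Record stable_subordinator (beta : R) (D : R -> T -> R) : Prop :=
  StableSubordinator {
  stable_levy : levy_process D ;
  stable_nondecreasing : forall s t w, 0 <= s -> s <= t -> D s w <= D t w ;
  stable_laplace : forall s t, 0 < s -> 0 <= t ->
    ('E_P[fun w => expR (- s * D t w)] = (expR (- t * s `^ beta))%:E)%E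
}.

(* On the null event where D stays below t, the infimum is inf set0 = 0. *)
Definition inverse_process (D : R -> T -> R) : R -> T -> R :=
  fun t w => inf [set x | 0 <= x /\ t < D x w].

Definition time_change (M : R -> T -> nat) (Y : R -> T -> R) : R -> T -> nat :=
  fun t w => M (Y t w) w.

Definition generalized_fractional_counting_process (k : nat)
    (lambda : 'I_k -> R) (beta : R) (Mbeta : R -> T -> nat) : Prop :=
  exists (M : R -> T -> nat) (D : R -> T -> R),
    [/\ generalized_counting_process lambda M,
        stable_subordinator beta D,
        independent_processes (nat_process M) (inverse_process D) &
        forall t, 0 <= t -> Mbeta t = time_change M (inverse_process D) t].

End processes.

(* Main.v *)
Require Import Defs.
From mathcomp Require Import all_boot all_order all_algebra.
From mathcomp Require Import all_classical all_reals all_analysis.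
From mathcomp Require Import measurable_realfun ring lra.

(** The law of M at a random independent time is a mixture of its laws at
    fixed times, and a mixture of Poisson-like weights is an exponential moment
    of the mixing variable.  With Y the inverse stable subordinator at time t,
    there are three facts to combine.

    The law of M(s).  Independent stationary increments make the laws of M a
    convolution semigroup on the naturals.  Another one is formed by the
    coefficients of exp(- Lambda s) prod_j exp(lambda_j s X^j), that is
    q_n(s) = sum_Omega (prod_j lambda_j^x_j / x_j!) s^z exp(- Lambda s).
    Both have the same derivative at s = 0, and two such semigroups which agree
    up to o(h) are equal ([substochastic_semigroup_unique], [gcp_marginal]).
    Approximating Y from the right by variables with countably many values,
    which is compatible with the right-continuity of the paths, gives
    Pr(M(Y) = n) = E q_n(Y) ([random_time_marginal]).  So, with
    F_m(u) = E(Y^m exp(- u Y)),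
    Pr(M(Y) = n) = sum_Omega (prod_j lambda_j^x_j / x_j!) F_z(Lambda).

    The Laplace transform of Y, F_0(u) = E_(beta,1)(- u t^beta)
    ([inverse_stable_laplace]).  As functions of t, both sides have Laplace
    transform s^(-1) (1 + u / s^beta)^(-1) at s: for the Mittag-Leffler function
    by integrating its series term by term, for E exp(- u Y_t) because the event
    D(x) <= t is, up to endpoints, the event x <= Y_t, and t |-> Pr(D(x) <= t)
    has transform s^(-1) exp(- x s^beta).  One side is monotone and the other
    continuous, so equal transforms force equality at every t > 0
    ([laplace_transform_inj_nonincreasing]).

    Differentiation.  Since F_m' = - F_(m+1), the i-th derivative of
    s^(z-1) F_0(Lambda / s) is a combination of the F_l(Lambda / s), l <= i.
    For i = z all terms but l = z cancel, and at s = 1 there remains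
    Lambda^z F_z(Lambda) ([derive1n_reciprocal_at1]).  Dividing by Lambda^z
    gives the term F_z(Lambda) of the mixture. *)

Set Implicit Arguments.
Unset Strict Implicit.
Unset Printing Implicit Defensive.

Import Order.TTheory GRing.Theory Num.Theory.
Import numFieldNormedType.Exports.

Local Open Scope classical_set_scope.
Local Open Scope ring_scope.

(** * Integrals of real-valued functions *)

Lemma dominated_cvg_Rintegral d (T : measurableType d) (R : realType)
    (mu : {measure set T -> \bar R}) (D : set T) (f_ : nat -> T -> R)
    (f g : T -> R) :
  measurable D -> (forall n, measurable_fun D (f_ n)) -> measurable_fun D f ->
  {ae mu, forall x, D x -> f_ n x @[n --> \oo] --> f x} ->
  mu.-integrable D (EFin \o g) ->
  (forall n x, D x -> `|f_ n x| <= g x) ->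
  mu.-integrable D (EFin \o f) /\
  (\int[mu]_(x in D) f_ n x) @[n --> \oo] --> \int[mu]_(x in D) f x.
Proof.
move=> mD mf_ mf f_f ig f_g.
have [|||||i _ cv] := @dominated_convergence _ _ _ mu D mD
  (fun n => EFin \o f_ n) (EFin \o f) (EFin \o g).
- by move=> n; apply/measurable_EFinP.
- exact/measurable_EFinP.
- apply: filterS f_f => x H Dx.
  by apply: cvg_EFin; [exact: nearW|exact: H].
- exact: ig.
- by apply: aeW => x n Dx /=; rewrite lee_fin; exact: f_g.
split => //; apply/fine_cvg; rewrite fineK//.
  exact: integrable_fin_num.
Qed.

Lemma le_integrable_R d (T : measurableType d) (R : realType)
    (mu : {measure set T -> \bar R}) (D : set T) (f g : T -> R) :
  measurable D -> measurable_fun D f ->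
  (forall x, D x -> `|f x| <= g x) ->
  mu.-integrable D (EFin \o g) -> mu.-integrable D (EFin \o f).
Proof.
move=> mD mf fg ig; apply: le_integrable ig => //.
- exact/measurable_EFinP.
- by move=> x Dx /=; rewrite lee_fin (le_trans (fg _ Dx))// ler_norm.
Qed.

Lemma integrable_scale d (T : measurableType d) (R : realType)
    (mu : {measure set T -> \bar R}) (D : set T) (f : T -> R) (r : R) :
  measurable D -> mu.-integrable D (EFin \o f) ->
  mu.-integrable D (EFin \o (fun x => r * f x)).
Proof.
move=> mD fi; have := integrableZl mD r fi.
by apply: eq_integrable => // x _ /=; rewrite EFinM.
Qed.

Lemma integrable_sub d (T : measurableType d) (R : realType)
    (mu : {measure set T -> \bar R}) (D : set T) (f g : T -> R) :
  measurable D -> mu.-integrable D (EFin \o f) ->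
  mu.-integrable D (EFin \o g) ->
  mu.-integrable D (EFin \o (fun x => f x - g x)).
Proof.
move=> mD fi gi; have := integrableB mD fi gi.
by apply: eq_integrable => // x _ /=; rewrite EFinB.
Qed.

Lemma integrable_Rsum d (T : measurableType d) (R : realType)
    (mu : {measure set T -> \bar R}) (D : set T) (I : Type) (r : seq I)
    (f : I -> T -> R) :
  measurable D -> (forall i, mu.-integrable D (EFin \o f i)) ->
  mu.-integrable D (EFin \o (fun x => \sum_(i <- r) f i x)).
Proof.
move=> mD fi.
have := @integrable_sum _ _ _ mu D mD I r xpredT (fun i x => (f i x)%:E).
move=> /(_ (fun i _ => fi i)); apply: eq_integrable => // x _ /=.
by rewrite sumEFin.
Qed.

Lemma Rintegral_sum d (T : measurableType d) (R : realType)
    (mu : {measure set T -> \bar R}) (D : set T) (I : Type) (r : seq I)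
    (f : I -> T -> R) :
  measurable D -> (forall i, mu.-integrable D (EFin \o f i)) ->
  \int[mu]_(x in D) (\sum_(i <- r) f i x) =
  \sum_(i <- r) \int[mu]_(x in D) f i x.
Proof.
move=> mD fi; elim: r => [|i r ih].
  by under eq_Rintegral do rewrite big_nil; rewrite Rintegral_cst// mul0r big_nil.
under eq_Rintegral do rewrite big_cons.
by rewrite RintegralD ?big_cons ?ih//; exact: integrable_Rsum.
Qed.

(** A bound on the integrals of an increasing sequence makes its limit
    integrable, which is how the dominating functions below are obtained. *)
Lemma integrable_monotone_limit d (T : measurableType d) (R : realType)
    (mu : {measure set T -> \bar R}) (D : set T) (f_ : nat -> T -> R)
    (f : T -> R) (C : R) :
  measurable D -> (forall n, measurable_fun D (f_ n)) -> measurable_fun D f ->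
  (forall n x, D x -> 0 <= f_ n x) ->
  (forall x, D x -> nondecreasing_seq (f_ ^~ x)) ->
  (forall x, D x -> f_ n x @[n --> \oo] --> f x) ->
  (forall n, \int[mu]_(x in D) (f_ n x)%:E <= C%:E)%E ->
  mu.-integrable D (EFin \o f).
Proof.
move=> mD mf_ mf f_0 f_nd f_f fC; apply/integrableP; split.
  exact/measurable_EFinP.
have f0 x : D x -> 0 <= f x.
  move=> Dx; have h := f_f _ Dx; rewrite -(cvg_lim _ h)//.
  by apply: limr_ge; [exact: cvgP h|apply: nearW => n; exact: f_0].
have nd : forall x, D x -> nondecreasing_seq ((fun n => EFin (f_ n x))).
  by move=> x Dx m n mn; rewrite lee_fin; exact: f_nd.
have mE n : measurable_fun D (EFin \o f_ n) by exact/measurable_EFinP.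
rewrite (eq_integral (fun x => limn (fun n => (f_ n x)%:E))); last first.
  move=> x /[!inE] Dx /=; rewrite ger0_norm ?f0//; apply/esym/cvg_lim => //.
  by apply: cvg_EFin; [exact: nearW|exact: f_f].
rewrite (@monotone_convergence _ _ _ mu D mD (fun n => EFin \o f_ n))//.
apply: (@le_lt_trans _ _ C%:E); last exact: ltry.
apply: lime_le; last exact: nearW.
apply: ereal_nondecreasing_is_cvgn => m n mn; apply: ge0_le_integral => //.
  by move=> x Dx; rewrite lee_fin; exact: f_0.
by move=> x Dx; rewrite lee_fin; exact: f_nd.
Qed.

(** Replacing g by the maximum of f and g changes nothing almost everywhere and
    reduces the claim to the pointwise comparison. *)
Lemma le_Rintegral_ae d (T : measurableType d) (R : realType)
    (mu : {measure set T -> \bar R}) (A : set T) (f g : T -> R) :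
  measurable A -> mu.-integrable A (EFin \o f) -> mu.-integrable A (EFin \o g) ->
  {ae mu, forall x, A x -> f x <= g x} ->
  \int[mu]_(x in A) f x <= \int[mu]_(x in A) g x.
Proof.
move=> mA fi gi fg; pose h x := Num.max (f x) (g x).
have mf : measurable_fun A f by case/integrableP : fi => /measurable_EFinP.
have mg : measurable_fun A g by case/integrableP : gi => /measurable_EFinP.
have mh : measurable_fun A h by exact: measurable_maxr.
have hi : mu.-integrable A (EFin \o h).
  have i : mu.-integrable A (EFin \o (fun x => `|f x| + `|g x|)).
    have := integrableD mA (integrable_norm fi) (integrable_norm gi).
    by apply: eq_integrable => // x _ /=; rewrite EFinD.
  apply: le_integrable_R i => // x _; rewrite /h.
  by case: (leP (f x) (g x)) => _; rewrite ?lerDl ?lerDr.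
have -> : \int[mu]_(x in A) g x = \int[mu]_(x in A) h x.
  rewrite /Rintegral; congr fine; apply: ae_eq_integral => //.
  - exact/measurable_EFinP.
  - exact/measurable_EFinP.
  - apply: filterS fg => x H Ax; congr EFin.
    by rewrite /h (max_idPr (H Ax)).
by apply: le_Rintegral => // x _; rewrite /h le_max lexx.
Qed.

Lemma integrable_bounded_prob d (T : measurableType d) (R : realType)
    (P : probability T R) (f : T -> R) (M : R) :
  measurable_fun setT f -> (forall x, `|f x| <= M) ->
  P.-integrable setT (EFin \o f).
Proof.
move=> mf fM; have iM := @finite_measure_integrable_cst _ _ _ P setT M measurableT.
by apply: le_integrable_R iM.
Qed.

Lemma Rintegral_indic_prob d (T : measurableType d) (R : realType)
    (P : probability T R) (A : set T) : measurable A ->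
  \int[P]_w \1_A w = fine (P A).
Proof. by move=> mA; rewrite /Rintegral integral_indic// setIT. Qed.

Lemma Rintegral_cst_prob d (T : measurableType d) (R : realType)
    (P : probability T R) (c : R) : \int[P]_w cst c w = c.
Proof.
rewrite Rintegral_cst//; have := probability_setT P.
by rewrite /= => ->; rewrite mulr1.
Qed.

(** * Uniqueness of Laplace transforms *)

Section laplace_uniqueness.
Context {R : realType}.
Local Notation mu := (@lebesgue_measure R).
Implicit Types (g : R -> R) (t T : R).

Lemma bernoulli_onem (x : R) n : 0 <= x <= 1 -> 1 - n%:R * x <= (1 - x) ^+ n.
Proof.
move=> /andP[x0 x1]; elim: n => [|n ih]; first by rewrite mul0r subr0 expr0.
rewrite exprS; have := ler_wpM2l (_ : 0 <= 1 - x) ih; rewrite subr_ge0.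
move=> /(_ x1); apply: le_trans; rewrite -natr1.
have : 0 <= n%:R * x * x by rewrite !mulr_ge0.
lra.
Qed.

Lemma measurable_expRN : measurable_fun setT (fun t => expR (- t) : R).
Proof. by apply: measurableT_comp => //; exact: measurable_funN. Qed.

(** A polynomial in exp(- t) which tends to the indicator of t > T: the exponent
    is about exp(n T), and (1 - exp(- n t))^exp(n T) is close to
    exp(- exp(n (T - t))). *)
Definition cutoff T (n : nat) t : R :=
  (1 - expR (- t) ^+ n) ^+ (Num.truncn (expR (n%:R * T))).+1.

Lemma expRN_itv t : 0 <= t -> 0 <= expR (- t) <= 1.
Proof. by move=> t0; rewrite expR_ge0 -[X in _ <= X]expR0 ler_expR oppr_le0. Qed.

Lemma cutoff_itv T n t : 0 <= t -> 0 <= cutoff T n t <= 1.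
Proof.
move=> /expRN_itv/andP[h0 h1].
have h : 0 <= 1 - expR (- t) ^+ n by rewrite subr_ge0 exprn_ile1.
by rewrite /cutoff exprn_ge0//= exprn_ile1// gerBl exprn_ge0.
Qed.

Lemma cutoff_lt T t : 0 < t -> t < T -> cutoff T n t @[n --> \oo] --> (0 : R).
Proof.
move=> t0 tT.
have h : expR (t - T) ^+ n @[n --> \oo] --> (0 : R).
  apply: cvg_expr; rewrite ger0_norm ?expR_ge0//.
  by rewrite -[ltRHS]expR0 ltr_expR subr_lt0.
apply: (@squeeze_cvgr _ _ _ _ (fun=> 0) _ _ _ _ _ h); last exact: cvg_cst.
apply: nearW => n; have /andP[-> _] /= := cutoff_itv T n (ltW t0).
rewrite /cutoff; set b := (Num.truncn _).+1.
have hb : expR (n%:R * T) <= b%:R by rewrite ltW// truncnS_gt.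
have /andP[u0 u1] := expRN_itv (ltW t0).
have h1 : 1 - expR (- t) ^+ n <= expR (- expR (- t) ^+ n) by exact: expR_ge1Dx.
have : (1 - expR (- t) ^+ n) ^+ b <= expR (- expR (- t) ^+ n) ^+ b.
  by rewrite lerXn2r// nnegrE ?expR_ge0// subr_ge0 exprn_ile1.
move=> /le_trans; apply.
rewrite -expRM_natl mulrN [leLHS]expRN -[leRHS]expRM_natl mulrBr.
have -> : expR (n%:R * t - n%:R * T) = (expR (n%:R * (T - t)))^-1.
  by rewrite -expRN; congr expR; lra.
rewrite lef_pV2 ?posrE ?expR_gt0//.
apply: le_trans (expR_ge1Dx _); rewrite -[leLHS]add0r lerD//.
rewrite -expRM_natl.
have -> : expR (n%:R * (T - t)) = expR (n%:R * T) * expR (n%:R * - t).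
  by rewrite -expRD; congr expR; lra.
by rewrite ler_wpM2r ?expR_ge0.
Qed.

Lemma cutoff_gt T t : 0 < t -> T < t -> cutoff T n t @[n --> \oo] --> (1 : R).
Proof.
move=> t0 tT.
have /andP[u0 u1] := expRN_itv (ltW t0).
have h : 1 - (expR (T - t) ^+ n + expR (- t) ^+ n) @[n --> \oo] --> (1 : R).
  rewrite (_ : 1 = 1 - (0 + 0) :> R); last by rewrite addr0 subr0.
  apply: cvgB; first by rewrite addr0 subr0; exact: cvg_cst.
  by apply: cvgD; apply: cvg_expr; rewrite ger0_norm ?expR_ge0//
    -[ltRHS]expR0 ltr_expR; lra.
apply: (@squeeze_cvgr _ _ _ _ _ (fun=> 1) _ _ _ h); last exact: cvg_cst.
apply: nearW => n; have /andP[_ ->] /= := cutoff_itv T n (ltW t0).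
rewrite andbT /cutoff; set b := (Num.truncn _).+1.
have hb : b%:R <= expR (n%:R * T) + 1.
  by rewrite -natr1 lerD2r truncn_le// expR_ge0.
apply: le_trans (bernoulli_onem _ _).
  rewrite lerD2l lerN2; apply: le_trans (ler_wpM2r _ hb) _.
    by rewrite exprn_ge0.
  rewrite mulrDl mul1r lerD2r -!expRM_natl -expRD ler_expR; lra.
by rewrite exprn_ge0//= exprn_ile1.
Qed.

Lemma measurable_exp_poly (p : {poly R}) :
  measurable_fun setT (fun t => p.[expR (- t)]).
Proof.
apply: (measurableT_comp (f := horner p)); last exact: measurable_expRN.
apply: continuous_measurable_fun; exact: continuous_horner.
Qed.

Lemma exp_poly_bounded (p : {poly R}) :
  exists M, forall t, 0 <= t -> `|p.[expR (- t)]| <= M.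
Proof.
exists (\sum_(i < size p) `|p`_i|) => t t0; rewrite horner_coef.
apply: le_trans (ler_norm_sum _ _ _) _; apply: ler_sum => i _.
have /andP[u0 u1] := expRN_itv t0.
by rewrite normrM ler_piMr// ger0_norm ?exprn_ge0 ?exprn_ile1.
Qed.

Lemma integrable_exp_poly (p : {poly R}) g :
  mu.-integrable `]0, +oo[ (EFin \o g) ->
  mu.-integrable `]0, +oo[ (EFin \o (fun t => p.[expR (- t)] * g t)).
Proof.
move=> ig; have [M hM] := exp_poly_bounded p.
have ig' : mu.-integrable `]0, +oo[ (EFin \o (fun t => M * `|g t|)).
  by apply: integrable_scale => //; exact: integrable_norm.
apply: le_integrable_R ig' => //.
  apply: measurable_funM; first exact: measurable_funTS (measurable_exp_poly p).
  by move/integrableP : ig => -[/measurable_EFinP].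
move=> x /=; rewrite in_itv/= andbT => x0; rewrite normrM.
by rewrite ler_wpM2r// hM// ltW.
Qed.

(** By linearity g is orthogonal to every polynomial in exp(- t), in particular
    to the cutoffs, which stay in [0, 1] and converge off the point T; dominated
    convergence concludes. *)
Lemma exp_moments_eq0 g :
  mu.-integrable `]0, +oo[ (EFin \o g) ->
  (forall n, \int[mu]_(t in `]0, +oo[) (expR (- t) ^+ n * g t) = 0) ->
  forall T, 0 < T -> \int[mu]_(t in `]T, +oo[) g t = 0.
Proof.
move=> ig g0 T T0.
(* The factor 'X^n makes the induction on the polynomial go through. *)
have pol (p : {poly R}) : \int[mu]_(t in `]0, +oo[) (p.[expR (- t)] * g t) = 0.
  suff h n : \int[mu]_(t in `]0, +oo[) ((p * 'X^n).[expR (- t)] * g t) = 0.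
    by have := h 0; rewrite expr0 mulr1.
  elim/poly_ind : p n => [n|p c ih n].
    by under eq_Rintegral do rewrite mul0r hornerC mul0r; rewrite Rintegral_cst ?mul0r.
  rewrite mulrDl -mulrA -exprS.
  under eq_Rintegral do rewrite hornerD mulrDl.
  rewrite RintegralD//; [|exact: integrable_exp_poly..].
  rewrite ih add0r.
  under eq_Rintegral do rewrite hornerM hornerC hornerXn -mulrA.
  rewrite RintegralZl ?g0 ?mulr0//.
  have := integrable_exp_poly 'X^n ig.
  by apply: eq_integrable => // t _ /=; rewrite hornerXn.
have cut n : \int[mu]_(t in `]0, +oo[) (cutoff T n t * g t) = 0.
  rewrite -[RHS](pol ((1 - 'X^n) ^+ (Num.truncn (expR (n%:R * T))).+1)).
  apply: eq_Rintegral => t _; congr (_ * _).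
  by rewrite horner_exp !hornerE.
have [||||||_ h] := @dominated_cvg_Rintegral _ _ _ mu `]0, +oo[
  (fun n t => cutoff T n t * g t) (fun t => \1_`]T, +oo[ t * g t)
  (fun t => `|g t|).
- done.
- move=> n; apply: measurable_funM; last first.
    by move/integrableP : ig => -[/measurable_EFinP].
  apply: measurable_funTS; apply: measurable_funX.
  by apply: measurable_funB => //; apply: measurable_funX; exact: measurable_expRN.
- apply: measurable_funM; last first.
    by move/integrableP : ig => -[/measurable_EFinP].
  by apply: measurable_funTS; exact: measurable_indic.
- exists [set T]; split; [exact: measurable_set1|exact: lebesgue_measure_set1|].
  move=> t /=; apply: contra_notP => tT; rewrite in_itv/= andbT => t0.
  apply: cvgM; last exact: cvg_cst.
  rewrite indicE mem_setE in_itv/= andbT.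
  case: (ltgtP T t) tT => // [Tt|tT|->] _ //; [exact: cutoff_gt|exact: cutoff_lt].
- exact: integrable_norm.
- move=> n t /=; rewrite in_itv/= andbT => t0.
  have /andP[c0 c1] := cutoff_itv T n (ltW t0).
  by rewrite normrM ler_piMl// ger0_norm.
have h0 : \int[mu]_(t in `]0, +oo[) (\1_`]T, +oo[ t * g t) = 0.
  rewrite -(cvg_lim _ h)//; under eq_fun do rewrite cut.
  exact: lim_cst.
rewrite (_ : `]T, +oo[%classic = `]0, +oo[ `&` `]T, +oo[); last first.
  by apply/seteqP; split => x /=; rewrite !in_itv/= !andbT; lra.
rewrite Rintegral_mkcondr -[RHS]h0.
apply: eq_Rintegral => t _; rewrite patchE indicE.
by case: ifP => _; rewrite ?mul1r ?mul0r.
Qed.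

(** The integral over ]a, b] is a difference of two tails, hence vanishes, while
    the lower bound c would make it at least c (b - a). *)
Lemma tail_integrals_eq0_not_ge g :
  mu.-integrable `]0, +oo[ (EFin \o g) ->
  (forall T, 0 < T -> \int[mu]_(t in `]T, +oo[) g t = 0) ->
  forall a b c : R, 0 < a -> a < b -> 0 < c ->
    ~ (forall t, a < t <= b -> c <= g t).
Proof.
move=> ig g0 a b c a0 ab c0 cg.
have sub0 (x : R) : 0 < x -> `]x, +oo[ `<=` (`]0, +oo[ : set R).
  by move=> x0 t /=; rewrite !in_itv/= !andbT; exact: lt_trans.
have igab : mu.-integrable `]a, b] (EFin \o g).
  apply: integrableS ig => // t /=; rewrite !in_itv/= andbT => /andP[+ _].
  exact: lt_trans.
have b0 : 0 < b by exact: lt_trans ab.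
have abE : `]a, +oo[%classic = `]a, b] `|` `]b, +oo[.
  apply/seteqP; split => t /=; rewrite !in_itv/= !andbT.
    by move=> ->; case: (leP t b) => ?; [left|right].
  by case=> [/andP[]//|]; exact: lt_trans.
have : \int[mu]_(t in `]a, b]) g t = 0.
  have := g0 _ a0; rewrite {1}abE Rintegral_setU//.
  - by rewrite g0// addr0.
  - by rewrite -abE; apply: integrableS ig => //; exact: sub0.
  - rewrite disj_set2E; apply/eqP/seteqP; split => t //=.
    by rewrite !in_itv/= andbT => -[/andP[_ tb]]; rewrite ltNge tb.
have : c * (b - a) <= \int[mu]_(t in `]a, b]) g t.
  have -> : c * (b - a) = \int[mu]_(t in `]a, b]) cst c t.
    rewrite Rintegral_cst//; congr (_ * _).
    have := @lebesgue_measure_itv R `]a, b].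
    by rewrite /= lte_fin ab => ->.
  apply: le_Rintegral => //.
  apply: le_integrable_R igab => // t /=; rewrite in_itv/= => abt.
  by rewrite ger0_norm ?cg// ltW.
move=> /[swap] ->; apply/negP; rewrite -ltNge mulr_gt0// subr_gt0//.
Qed.

(** The difference of the two functions, damped by exp(- s t), has vanishing
    tails.  If h1 and h2 differed at t0, then monotonicity of h1 and continuity of
    h2 would keep them apart on a whole interval on one side of t0.  Comparing the
    transforms at s, s + 1, s + 2, ... only is what allows an application where
    the transform is known for large arguments only. *)
Lemma laplace_transform_inj_nonincreasing (h1 h2 : R -> R) (s : R) : 0 <= s ->
  {homo h1 : x y /~ x <= y} ->
  (forall t, 0 < t -> {for t, continuous h2}) ->
  mu.-integrable `]0, +oo[ (EFin \o (fun t => expR (- s * t) * h1 t)) ->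
  mu.-integrable `]0, +oo[ (EFin \o (fun t => expR (- s * t) * h2 t)) ->
  (forall n : nat,
    \int[mu]_(t in `]0, +oo[) (expR (- (s + n%:R) * t) * h1 t) =
    \int[mu]_(t in `]0, +oo[) (expR (- (s + n%:R) * t) * h2 t)) ->
  forall t, 0 < t -> h1 t = h2 t.
Proof.
move=> s0 h1_ni h2_cont i1 i2 h12 t0 t0_gt0.
(* The factor c is 1 or -1, to treat both signs of h1 t0 - h2 t0 at once. *)
pose g c t := expR (- s * t) * (c * (h1 t - h2 t)).
have ig c : mu.-integrable `]0, +oo[ (EFin \o g c).
  have := integrable_scale c _ (integrable_sub _ i1 i2).
  move=> /(_ (measurable_itv _) (measurable_itv _)).
  apply: eq_integrable => // t _ /=; rewrite /g; congr EFin; ring.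
have g0 c T : 0 < T -> \int[mu]_(t in `]T, +oo[) g c t = 0.
  move: T; apply: exp_moments_eq0 => [|n]; first exact: ig.
  have E t : expR (- (s + n%:R) * t) = expR (- t) ^+ n * expR (- s * t).
    by rewrite -expRM_natl -expRD; congr expR; ring.
  have i h : mu.-integrable `]0, +oo[ (EFin \o (fun t => expR (- s * t) * h t)) ->
      mu.-integrable `]0, +oo[
        (EFin \o (fun t => expR (- (s + n%:R) * t) * h t)).
    move=> /(integrable_exp_poly 'X^n); apply: eq_integrable => // t _ /=.
    by rewrite hornerXn E mulrA.
  transitivity (c * (\int[mu]_(t in `]0, +oo[) (expR (- (s + n%:R) * t) * h1 t) -
      \int[mu]_(t in `]0, +oo[) (expR (- (s + n%:R) * t) * h2 t))).
    rewrite -RintegralB//; [|exact: i..].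
    rewrite -RintegralZl//; last by apply: integrable_sub => //; exact: i.
    by apply: eq_Rintegral => t _; rewrite E /g; ring.
  by rewrite h12 subrr mulr0.
have pos c a b k : 0 < a -> a < b -> 0 < k ->
    ~ (forall t, a < t <= b -> k <= c * (h1 t - h2 t)).
  move=> a0 ab k0 H.
  apply: (@tail_integrals_eq0_not_ge (g c) (ig c) (g0 c) a b
    (expR (- s * b) * k)) => //; first by rewrite mulr_gt0 ?expR_gt0.
  move=> t /[dup] /andP[_ tb] /H {}H; rewrite /g ler_pM ?expR_ge0 ?(ltW k0)//.
  by rewrite ler_expR !mulNr lerN2 ler_wpM2l.
have close e : 0 < e -> exists2 d, 0 < d &
    forall t, `|t0 - t| < d -> `|h2 t0 - h2 t| < e.
  move=> e0; have /cvgrPdist_lt/(_ _ e0) := h2_cont _ t0_gt0.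
  by move=> /nbhs_ballP[d d0 dH]; exists d => // t /dH.
have [lt12|lt21|//] := ltgtP (h1 t0) (h2 t0); exfalso.
- have e0 : 0 < (h2 t0 - h1 t0) / 2 by rewrite divr_gt0// subr_gt0.
  have [d d0 dH] := close _ e0.
  apply: (@pos (- 1) t0 (t0 + d / 2) ((h2 t0 - h1 t0) / 2)) => //.
    by rewrite ltrDl divr_gt0.
  move=> t /andP[tt0 ttd].
  have /dH : `|t0 - t| < d by rewrite ltr_norml; lra.
  have := h1_ni _ _ (ltW tt0).
  rewrite ltr_norml; lra.
- have e0 : 0 < (h1 t0 - h2 t0) / 2 by rewrite divr_gt0// subr_gt0.
  have [d d0 dH] := close _ e0.
  pose a := Num.max (t0 / 2) (t0 - d / 2).
  have at0 : a < t0 by rewrite /a gt_max; lra.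
  have a0 : 0 < a by rewrite /a lt_max; lra.
  have ad : t0 - d / 2 <= a by rewrite /a le_max lexx orbT.
  apply: (@pos 1 a t0 ((h1 t0 - h2 t0) / 2)) => //.
  move=> t /andP[tt0 ttd].
  have /dH : `|t0 - t| < d by rewrite ltr_norml; lra.
  have := h1_ni _ _ ttd.
  rewrite ltr_norml; lra.
Qed.

End laplace_uniqueness.

(** * Exponential and Gamma integrals *)

Section gamma_integrals.
Context {R : realType}.
Local Notation mu := (@lebesgue_measure R).

Lemma continuous_expRM (s : R) : continuous (fun t : R => expR (s * t)).
Proof.
move=> t; apply: continuous_comp; last exact: continuous_expR.
by apply: continuousM => //; exact: cst_continuous.
Qed.

Lemma measurable_expRM (s : R) : measurable_fun setT (fun t : R => expR (s * t)).
Proof. by apply: continuous_measurable_fun; exact: continuous_expRM. Qed.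

Lemma is_derive_expRM (s t : R) :
  is_derive t 1 (fun t => expR (s * t)) (s * expR (s * t)).
Proof.
have -> : s * expR (s * t) = expR (s * t) * (s *: 1).
  by rewrite /GRing.scale/= mulr1 mulrC.
exact: (@is_derive1_comp _ expR (s \*: id) t).
Qed.

Lemma integral_expR_tail (s x : R) : 0 < s ->
  (\int[mu]_(t in `[x, +oo[) (s * expR (- s * t))%:E = (expR (- s * x))%:E)%E.
Proof.
move=> s0.
rewrite (@ge0_continuous_FTC2y _ _ (fun t => - (expR (- s * t))) _ 0)//.
- by rewrite EFinN oppeK add0e.
- by move=> t _; rewrite mulr_ge0 ?expR_ge0// ltW.
- apply: continuous_subspaceT => t.
  by apply: cvgM; [exact: cvg_cst|exact: continuous_expRM].
- rewrite -oppr0; apply: cvgN.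
  rewrite (_ : (fun x => expR (- s * x)) =
               (fun z => expR (- z)) \o (fun z => s * z)); last first.
    by apply: eq_fun => t; rewrite mulNr.
  apply: (@cvg_comp _ _ _ _ _ _ (pinfty_nbhs R)); last exact: cvgr_expR.
  exact: gt0_cvgMry.
- by apply: cvgN; apply/cvg_at_right_filter; exact: continuous_expRM.
- move=> t _; rewrite derive1E.
  have dE := is_derive_expRM (- s) t.
  by rewrite deriveN// derive_val mulNr opprK.
Qed.

Lemma integrable_expRN (s : R) : 0 < s ->
  mu.-integrable `]0, +oo[ (EFin \o (fun t => expR (- s * t))).
Proof.
move=> s0; apply/integrableP; split.
  by apply/measurable_EFinP/measurable_funTS; exact: measurable_expRM.
under eq_integral do rewrite /= ger0_norm ?expR_ge0//.
rewrite [ltLHS](_ : _ = (s^-1)%:E); first exact: ltry.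
rewrite integral_itv_obnd_cbnd; last first.
  by apply/measurable_EFinP/measurable_funTS; exact: measurable_expRM.
have := integral_expR_tail 0 s0; rewrite mulr0 expR0.
under eq_integral do rewrite EFinM.
rewrite ge0_integralZl//=; last 2 first.
  by apply/measurable_EFinP/measurable_funTS; exact: measurable_expRM.
  by rewrite lee_fin ltW.
move=> h; rewrite -[RHS]mule1 -h muleA -EFinM mulVf ?gt_eqF// mul1e.
by [].
Qed.

Lemma Rintegral_expRN (s : R) : 0 < s ->
  \int[mu]_(t in `]0, +oo[) expR (- s * t) = s^-1.
Proof.
move=> s0; apply: (mulfI (lt0r_neq0 s0)).
rewrite -RintegralZl//; last exact: integrable_expRN.
rewrite mulfV ?gt_eqF// /Rintegral integral_itv_obnd_cbnd; last first.
  apply/measurable_EFinP/measurable_funTS; apply: measurable_funM => //.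
  exact: measurable_expRM.
by rewrite integral_expR_tail//= mulr0 expR0.
Qed.

Lemma powR_le_expR (s a : R) : 0 < s -> 0 <= a ->
  exists2 C : R, 0 <= C & forall t, 0 < t -> t `^ a <= C * expR (s / 2 * t).
Proof.
move=> s0 a0; pose b := (2 * (a + 1)) / s.
have b0 : 0 < b by rewrite divr_gt0// mulr_gt0//; lra.
exists (b `^ a); first exact: powR_ge0.
move=> t t0; rewrite -{1}(divfK (lt0r_neq0 b0) t).
have tb0 : 0 < t / b by rewrite divr_gt0.
rewrite powRM ?(ltW tb0) ?(ltW b0)// mulrC ler_wpM2l ?powR_ge0//.
have -> : s / 2 * t = (t / b) * (a + 1).
  by rewrite /b; field; rewrite gt_eqF//=; lra.
rewrite /powR gt_eqF// ler_expR mulrC.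
apply: (@le_trans _ _ ((t / b) * a)); last by rewrite ler_wpM2l//; lra.
rewrite ler_wpM2r// -ler_expR lnK ?posrE//.
by apply: le_trans (expR_ge1Dx _); lra.
Qed.

Lemma integrable_powR_expR (s a : R) : 0 < s -> 0 <= a ->
  mu.-integrable `]0, +oo[ (EFin \o (fun t => t `^ a * expR (- s * t))).
Proof.
move=> s0 a0; have [C C0 hC] := powR_le_expR s0 a0.
have s20 : 0 < s / 2 by rewrite divr_gt0.
have /(_ (measurable_itv _)) ig := integrable_scale C _ (integrable_expRN s20).
apply: le_integrable_R ig => //.
  apply: measurable_funTS; apply: measurable_funM; last exact: measurable_expRM.
  exact: measurable_powR.
move=> t /=; rewrite in_itv/= andbT => t0.
rewrite ger0_norm ?mulr_ge0 ?powR_ge0 ?expR_ge0//.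
apply: le_trans (ler_wpM2r (expR_ge0 _) (hC _ t0)) _.
by rewrite -(mulrA C) -expRD ler_wpM2l// ler_expR; lra.
Qed.

Lemma Rintegral_eq_EFin d (T : measurableType d) (nu : {measure set T -> \bar R})
  (D : set T) (f : T -> R) :
  measurable D -> nu.-integrable D (EFin \o f) ->
  (\int[nu]_(x in D) (f x)%:E = (\int[nu]_(x in D) f x)%R%:E)%E.
Proof. by move=> mD i; rewrite /Rintegral fineK//; exact: integrable_fin_num. Qed.

Lemma continuous_powR_expR (a : R) : 0 <= a ->
  {within `[0, +oo[, continuous (fun t : R => t `^ a * expR (- t))}.
Proof.
move=> a0; apply/continuous_within_itvcyP.
have cN (t : R) : expR (- x) @[x --> t] --> expR (- t).
  by apply: continuous_comp; [exact: continuousN|exact: continuous_expR].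
split => [t|].
  rewrite in_itv/= andbT => t0; apply: cvgM; last exact: cN.
  have : derivable (fun x : R => x `^ a) t 1.
    by apply: derivable_powR; rewrite in_itv/= andbT.
  by move=> /derivable1_diffP/differentiable_continuous.
apply: cvgM; last by apply: cvg_at_right_filter; exact: cN.
move: a0; rewrite le_eqVlt => /predU1P[<-|a0].
  by under eq_fun do rewrite powRr0; rewrite powRr0; exact: cvg_cst.
by rewrite powR0 ?gt_eqF//; exact: powR_cvg0.
Qed.

(** The substitution t |-> s t turns the integral into the one defining
    Gamma. *)
Lemma laplace_powR (s a : R) : 0 < s -> 0 <= a ->
  \int[mu]_(t in `]0, +oo[) (t `^ a * expR (- s * t)) =
  Gamma (a + 1) / s `^ (a + 1).
Proof.
move=> s0 a0.
have sa_gt0 : 0 < s `^ (a + 1) by exact: powR_gt0.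
have dF (x : R) : is_derive x 1 (fun t => s * t) s.
  have h : is_derive x 1 (fun t => s * t) (s *: (1 : R)) by exact: is_deriveZ.
  by move: h; rewrite /GRing.scale/= mulr1.
have dFE : derive1 (fun t : R => s * t) = cst s.
  by apply/funext => x; rewrite derive1E; case: (dF x).
have E : (\int[mu]_(t in `[0%R, +oo[) (t `^ a * expR (- t))%:E =
   \int[mu]_(t in `[0%R, +oo[) (s `^ (a + 1) * (t `^ a * expR (- s * t)))%:E)%E.
  have := @increasing_ge0_integration_by_substitutiony _ (fun t : R => s * t)
    (fun t => t `^ a * expR (- t)) 0.
  rewrite mulr0 => ->.
  - apply: eq_integral => t; rewrite inE/= in_itv/= andbT => t0; congr EFin.
    rewrite fctE dFE/= powRM ?(ltW s0)// powRD; last first.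
      by rewrite (gt_eqF s0) implybT.
    by rewrite powRr1 ?(ltW s0)// mulNr; ring.
  - by move=> x y _ _ xy; rewrite ltr_pM2l.
  - by rewrite dFE => x _; exact: cst_continuous.
  - by rewrite dFE; exact: is_cvg_cst.
  - by rewrite dFE; exact: is_cvg_cst.
  - split=> [x _|]; first by case: (dF x).
    by apply: cvg_at_right_filter; apply: cvgMr; exact: cvg_id.
  - exact: gt0_cvgMry.
  - exact: continuous_powR_expR.
  - by move=> t _; rewrite mulr_ge0 ?powR_ge0 ?expR_ge0.
apply: (mulfI (lt0r_neq0 sa_gt0)); rewrite [RHS]mulrC divfK ?gt_eqF//.
have i1 := integrable_powR_expR s0 a0.
rewrite -RintegralZl// /Gamma /Rintegral; congr fine.
rewrite addrK integral_itv_obnd_cbnd; last first.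
  apply/measurable_EFinP; apply: measurable_funM => //.
  by case/integrableP: i1 => /measurable_EFinP.
rewrite -E integral_itv_obnd_cbnd//.
case/integrableP: (integrable_powR_expR ltr01 a0) => + _.
by apply: eq_measurable_fun => t _ /=; rewrite mulN1r.
Qed.

(** Only the interval [c, c + 1] is kept in the integral.  Since c is free, this
    bound shows that Gamma outgrows every geometric progression. *)
Lemma Gamma_ge (a c : R) : 0 <= a -> 0 < c ->
  c `^ a * expR (- (c + 1)) <= Gamma (a + 1).
Proof.
move=> a0 c0.
have i1 : mu.-integrable `]0, +oo[ (EFin \o (fun t => t `^ a * expR (- t))).
  have := integrable_powR_expR ltr01 a0.
  by apply: eq_integrable => // t _ /=; rewrite mulN1r.
have sub : `[c, c + 1] `<=` (`]0, +oo[ : set R).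
  move=> t /=; rewrite !in_itv/= andbT => /andP[+ _]; exact: lt_le_trans.
have i2 : mu.-integrable `[c, c + 1] (EFin \o (fun t => t `^ a * expR (- t))).
  exact: integrableS i1.
have -> : c `^ a * expR (- (c + 1)) =
    \int[mu]_(t in `[c, c + 1]) (cst (c `^ a * expR (- (c + 1))) t).
  rewrite Rintegral_cst//.
  have := @lebesgue_measure_itv R `[c, c + 1].
  by rewrite /= lte_fin ltrDl ltr01 => ->; rewrite /= addrAC subrr add0r mulr1.
have le1 t : c <= t <= c + 1 ->
    c `^ a * expR (- (c + 1)) <= t `^ a * expR (- t).
  move=> /andP[ct tc]; apply: ler_pM; rewrite ?powR_ge0 ?expR_ge0//.
    by apply: ge0_ler_powR => //; rewrite nnegrE; lra.
  by rewrite ler_expR lerN2.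
apply: (@le_trans _ _ (\int[mu]_(t in `[c, c + 1]) (t `^ a * expR (- t)))).
  apply: le_Rintegral => //.
  apply: le_integrable_R i2 => // t /=; rewrite in_itv/= => /le1.
  by rewrite ger0_norm ?mulr_ge0 ?powR_ge0 ?expR_ge0.
rewrite /Gamma /Rintegral addrK fine_le//.
- exact: integrable_fin_num.
- exact: integrable_fin_num.
- apply: ge0_subset_integral => //.
    by case/integrableP : i1.
  by move=> t _; rewrite lee_fin mulr_ge0 ?powR_ge0 ?expR_ge0.
Qed.

Lemma Gamma_gt0 (a : R) : 0 <= a -> 0 < Gamma (a + 1).
Proof.
move=> a0; apply: lt_le_trans (Gamma_ge a0 ltr01).
by rewrite mulr_gt0 ?powR_gt0 ?expR_gt0.
Qed.

End gamma_integrals.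

(** * The Mittag-Leffler function and its Laplace transform *)

Section mittag_leffler.
Context {R : realType}.
Local Notation mu := (@lebesgue_measure R).

(** An infinite radius of convergence, phrased as domination by every geometric
    sequence, a form which formal differentiation visibly preserves. *)
Definition entire_coeffs (c : R^nat) :=
  forall r : R, 0 < r -> exists C : R, forall j, `|c j| <= C * r ^+ j.

Lemma entire_coeffs_diffs c : entire_coeffs c -> entire_coeffs (pseries_diffs c).
Proof.
move=> ec r r0; have r20 : 0 < r / 2 by rewrite divr_gt0.
have [C hC] := ec _ r20; exists (C * r) => j.
have C0 : 0 <= C by have := hC 0; rewrite expr0 mulr1; exact: le_trans.
rewrite /pseries_diffs normrM ger0_norm//.
apply: le_trans (ler_wpM2l (ler0n _ _) (hC j.+1)) _.
rewrite mulrCA -mulrA ler_wpM2l// -exprS expr_div_n mulrCA ler_piMr//.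
  by rewrite exprn_ge0// ltW.
rewrite ler_pdivrMr ?exprn_gt0// mul1r -natrX ler_nat.
exact: ltnW (ltn_expl j.+1 _).
Qed.

Lemma entire_coeffs_cvg_norm c (x : R) : entire_coeffs c ->
  cvgn [series `|c j * x ^+ j|]_j.
Proof.
move=> ec; have r0 : 0 < (2 * (`|x| + 1))^-1.
  by rewrite invr_gt0 mulr_gt0// ltr_wpDl.
have [C hC] := ec _ r0.
have C0 : 0 <= C by have := hC 0; rewrite expr0 mulr1; exact: le_trans.
apply: (@series_le_cvg _ _ (geometric C (2^-1))) => //=.
- by move=> n; rewrite mulr_ge0// exprn_ge0.
- move=> n; rewrite normrM normrX.
  apply: le_trans (ler_wpM2r _ (hC n)) _; first by rewrite exprn_ge0.
  rewrite -mulrA ler_wpM2l// -exprMn.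
  apply: lerXn2r; rewrite ?nnegrE ?invr_ge0//.
  rewrite mulrC ler_pdivrMr ?mulr_gt0 ?ltr_wpDl//.
  by rewrite mulrA mulVf// mul1r lerDl.
- by apply: is_cvg_geometric_series; rewrite ger0_norm// invf_lt1// ltr1n.
Qed.

Lemma entire_coeffs_cvg c (x : R) : entire_coeffs c -> cvgn (pseries c x).
Proof. by move=> ec; apply: normed_cvg; exact: entire_coeffs_cvg_norm. Qed.

Lemma entire_coeffs_continuous c : entire_coeffs c ->
  continuous (fun x : R => limn (pseries c x)).
Proof.
move=> ec x.
have := @pseries_snd_diffs R c (`|x| + 1) x.
move=> /(_ (@entire_coeffs_cvg _ _ ec)
  (@entire_coeffs_cvg _ _ (entire_coeffs_diffs ec))
  (@entire_coeffs_cvg _ _ (entire_coeffs_diffs (entire_coeffs_diffs ec)))).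
have -> : `|x| < `| `|x| + 1| by rewrite [ltRHS]ger0_norm ?addr_ge0// ltrDl.
by move=> /(_ isT) [/derivable1_diffP/differentiable_continuous].
Qed.

Variable beta : R.
Hypothesis beta0 : 0 < beta.

Definition ml_coeff (j : nat) : R := (Gamma (j%:R * beta + 1))^-1.

Lemma ml_coeff_gt0 j : 0 < ml_coeff j.
Proof. by rewrite invr_gt0 Gamma_gt0// mulr_ge0// ltW. Qed.

Lemma mittag_lefflerE x : mittag_leffler beta 1 x = limn (pseries ml_coeff x).
Proof.
rewrite /mittag_leffler /pseries; congr (limn (series _)).
by apply/funext => j /=; rewrite /ml_coeff mulrC.
Qed.

Lemma entire_ml_coeff : entire_coeffs ml_coeff.
Proof.
(* With this c the lower bound on Gamma (j beta + 1) is a multiple of r ^- j. *)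
move=> r r0; pose c := r^-1 `^ (beta^-1).
have c0 : 0 < c by rewrite powR_gt0 ?invr_gt0.
exists (expR (c + 1)) => j.
have jb0 : 0 <= j%:R * beta by rewrite mulr_ge0// ltW.
rewrite gtr0_norm ?ml_coeff_gt0//.
have := Gamma_ge jb0 c0.
have -> : c `^ (j%:R * beta) = r ^- j.
  rewrite [_ * beta]mulrC powRrM /c -(powRrM r^-1) mulVf ?gt_eqF//.
  rewrite powRr1 ?invr_ge0 ?ltW//.
  by rewrite powR_mulrn ?invr_ge0 ?ltW// exprVn.
move=> h; rewrite [leRHS](_ : _ = (r ^- j * expR (- (c + 1)))^-1); last first.
  by rewrite expRN -invfM invrK mulrC.
rewrite lef_pV2// posrE ?Gamma_gt0//.
by rewrite mulr_gt0 ?expR_gt0// invr_gt0 exprn_gt0.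
Qed.

Lemma mittag_leffler_cvg x :
  pseries ml_coeff x n @[n --> \oo] --> mittag_leffler beta 1 x.
Proof. by rewrite mittag_lefflerE; exact: entire_coeffs_cvg entire_ml_coeff. Qed.

Lemma mittag_leffler_continuous : continuous (mittag_leffler beta 1).
Proof.
rewrite (_ : mittag_leffler beta 1 = fun x => limn (pseries ml_coeff x)).
  exact: entire_coeffs_continuous entire_ml_coeff.
by apply/funext => x; rewrite mittag_lefflerE.
Qed.

Let term (v s : R) j t := ml_coeff j * v ^+ j * (t `^ (j%:R * beta) * expR (- s * t)).

Let jbeta_ge0 j : 0 <= j%:R * beta. Proof. by rewrite mulr_ge0// ltW. Qed.

Let integrable_term (v s : R) j : 0 < s ->
  mu.-integrable `]0, +oo[ (EFin \o term v s j).
Proof.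
move=> s0; apply: integrable_scale; first exact: measurable_itv.
exact: integrable_powR_expR.
Qed.

Let partialE (v s t : R) n : 0 < t ->
  expR (- s * t) * pseries ml_coeff (v * t `^ beta) n =
  \sum_(j <- index_iota 0 n) term v s j t.
Proof.
move=> t0; rewrite /pseries /series/= mulr_sumr; apply: eq_bigr => j _.
rewrite exprMn -(powR_mulrn _ (powR_ge0 _ _)) -powRrM /term [beta * _]mulrC.
by ring.
Qed.

Let laplace_partial (v s : R) n : 0 < s ->
  \int[mu]_(t in `]0, +oo[)
    (expR (- s * t) * pseries ml_coeff (v * t `^ beta) n) =
  series (geometric s^-1 (v / s `^ beta)) n.
Proof.
move=> s0.
transitivity (\int[mu]_(t in `]0, +oo[)
    (\sum_(j <- index_iota 0 n) term v s j t)).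
  apply: eq_Rintegral => t; rewrite inE/= in_itv/= andbT; exact: partialE.
rewrite Rintegral_sum//; last by move=> j; exact: integrable_term.
rewrite /series/=; apply: eq_bigr => j _.
rewrite RintegralZl//; last exact: integrable_powR_expR.
rewrite laplace_powR// /ml_coeff.
have -> : s `^ (j%:R * beta + 1) = (s `^ beta) ^+ j * s.
  rewrite powRD ?(gt_eqF s0) ?implybT// powRr1 ?(ltW s0)//.
  by rewrite [j%:R * beta]mulrC powRrM powR_mulrn ?powR_ge0.
rewrite expr_div_n; field.
by rewrite expf_neq0 ?gt_eqF ?powR_gt0 ?Gamma_gt0.
Qed.

Let integrable_partial (v s : R) n : 0 < s ->
  mu.-integrable `]0, +oo[
    (EFin \o (fun t => expR (- s * t) * pseries ml_coeff (v * t `^ beta) n)).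
Proof.
move=> s0.
have : mu.-integrable `]0, +oo[
    (EFin \o (fun t => \sum_(j <- index_iota 0 n) term v s j t)).
  by apply: integrable_Rsum => // j; exact: integrable_term.
apply: eq_integrable => // t; rewrite inE/= in_itv/= andbT => t0.
by rewrite partialE.
Qed.

Let measurable_ml (v s : R) : measurable_fun (`]0, +oo[%classic : set R)
  (fun t : R => expR (- s * t) * mittag_leffler beta 1 (v * t `^ beta)).
Proof.
apply: measurable_funTS; apply: measurable_funM; first exact: measurable_expRM.
apply: measurableT_comp.
  by apply: continuous_measurable_fun; exact: mittag_leffler_continuous.
by apply: measurable_funM => //; exact: measurable_powR.
Qed.

Let partial_cvg (v s t : R) :
  expR (- s * t) * pseries ml_coeff (v * t `^ beta) n @[n --> \oo] -->
  expR (- s * t) * mittag_leffler beta 1 (v * t `^ beta).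
Proof. by apply: cvgMr; exact: mittag_leffler_cvg. Qed.

Let partial_nd (u s t : R) : 0 <= u ->
  nondecreasing_seq (fun n => expR (- s * t) * pseries ml_coeff (u * t `^ beta) n).
Proof.
move=> u0 m n mn; rewrite ler_wpM2l ?expR_ge0//.
apply: nondecreasing_series mn => i _ _.
by rewrite mulr_ge0 ?(ltW (ml_coeff_gt0 _))// exprn_ge0// mulr_ge0// powR_ge0.
Qed.

(** For a nonnegative argument the partial sums increase, and their integrals are
    bounded by a geometric series of ratio u / s^beta < 1. *)
Let integrable_ml_ge0 (u s : R) : 0 <= u -> 0 < s -> u < s `^ beta ->
  mu.-integrable `]0, +oo[
    (EFin \o (fun t => expR (- s * t) * mittag_leffler beta 1 (u * t `^ beta))).
Proof.
move=> u0 s0 us.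
have z0 : 0 <= u / s `^ beta by rewrite divr_ge0 ?powR_ge0.
have z1 : `|u / s `^ beta| < 1.
  by rewrite ger0_norm// ltr_pdivrMr ?powR_gt0// mul1r.
apply: (@integrable_monotone_limit _ _ _ mu _
  (fun n t => expR (- s * t) * pseries ml_coeff (u * t `^ beta) n) _
  (s^-1 * (1 - u / s `^ beta)^-1)) => //.
- move=> n; have := integrable_partial u n s0.
  by case/integrableP => /measurable_EFinP.
- exact: measurable_ml.
- move=> n t _; rewrite mulr_ge0 ?expR_ge0// sumr_ge0// => i _.
  by rewrite mulr_ge0 ?(ltW (ml_coeff_gt0 _))// exprn_ge0// mulr_ge0// powR_ge0.
- by move=> t _; exact: partial_nd.
- move=> n; rewrite Rintegral_eq_EFin//; last exact: integrable_partial.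
  rewrite lee_fin laplace_partial//.
  have h := @cvg_geometric_series R s^-1 _ z1.
  rewrite -(cvg_lim _ h)//; apply: nondecreasing_cvgn_le; last exact: cvgP h.
  apply: nondecreasing_series => i _ _.
  by rewrite mulr_ge0 ?invr_ge0 ?(ltW s0)// exprn_ge0.
Qed.

(** Termwise integration of the series yields a geometric series of ratio
    - u / s^beta.  The partial sums are dominated by the function at the opposite
    argument u t^beta, which is integrable because u < s^beta. *)
Lemma laplace_mittag_leffler (u s : R) : 0 <= u -> 0 < s -> u < s `^ beta ->
  mu.-integrable `]0, +oo[ (EFin \o
    (fun t => expR (- s * t) * mittag_leffler beta 1 (- u * t `^ beta))) /\
  \int[mu]_(t in `]0, +oo[)
    (expR (- s * t) * mittag_leffler beta 1 (- u * t `^ beta)) =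
  s^-1 * (1 + u / s `^ beta)^-1.
Proof.
move=> u0 s0 us.
have z1 : `|- u / s `^ beta| < 1.
  rewrite mulNr normrN ger0_norm ?divr_ge0 ?powR_ge0//.
  by rewrite ltr_pdivrMr ?powR_gt0// mul1r.
have [||||||i h] := @dominated_cvg_Rintegral _ _ _ mu `]0, +oo[
  (fun n t => expR (- s * t) * pseries ml_coeff (- u * t `^ beta) n)
  (fun t => expR (- s * t) * mittag_leffler beta 1 (- u * t `^ beta))
  (fun t => expR (- s * t) * mittag_leffler beta 1 (u * t `^ beta)).
- done.
- move=> n; have := integrable_partial (- u) n s0.
  by case/integrableP => /measurable_EFinP.
- exact: measurable_ml.
- by apply: aeW => t _; exact: partial_cvg.
- exact: integrable_ml_ge0.
- move=> n t _; rewrite normrM (ger0_norm (expR_ge0 _)).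
  apply: (@le_trans _ _ (expR (- s * t) * pseries ml_coeff (u * t `^ beta) n)).
    rewrite ler_wpM2l ?expR_ge0//; apply: le_trans (ler_norm_sum _ _ _) _.
    apply: ler_sum => j _; rewrite normrM normrX normrM normrN.
    by rewrite (ger0_norm u0) (ger0_norm (powR_ge0 _ _)) (gtr0_norm (ml_coeff_gt0 _)).
  rewrite -(cvg_lim _ (@partial_cvg u s t))//.
  by apply: nondecreasing_cvgn_le; [exact: partial_nd|exact: cvgP (@partial_cvg u s t)].
split => //; rewrite -(cvg_lim _ h)//.
under eq_fun do rewrite laplace_partial//.
rewrite -[u / _]opprK -mulNr.
exact: cvg_lim (@cvg_geometric_series R s^-1 _ z1).
Qed.

End mittag_leffler.

(** * Laplace transform of a distribution function *)

Section laplace_of_cdf.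
Context {d : measure_display} {T : measurableType d} {R : realType}.
Variable P : probability T R.
Local Notation mu := (@lebesgue_measure R).

Lemma measurable_le_rv (X : T -> R) (t : R) : measurable_fun setT X ->
  measurable [set w | X w <= t].
Proof.
move=> mX; have := mX measurableT `]-oo, t]%classic (measurable_itv _).
by rewrite setTI; congr measurable; apply/seteqP; split => w /=; rewrite in_itv.
Qed.

(** Tonelli's theorem for s exp(- s t) on the region X w <= t: integrating first
    in t gives the tail exp(- s X w). *)
Lemma laplace_cdf_ereal (X : T -> R) (s : R) : measurable_fun setT X ->
  (forall w, 0 <= X w) -> 0 < s ->
  (\int[mu]_(t in `]0%R, +oo[) ((s * expR (- s * t))%:E * P [set w | X w <= t]%R) =
   \int[P]_w (expR (- s * X w))%:E)%E.
Proof.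
move=> mX X0 s0.
pose GR := measurableTypeR R.
pose A := [set z : T * GR | X z.1 <= z.2].
have mA : measurable A.
  have m : measurable_fun setT (fun z : T * GR => z.2 - X z.1).
    apply: measurable_funB => //; exact: measurableT_comp.
  have := m measurableT `[0, +oo[%classic (measurable_itv _).
  rewrite setTI; congr measurable; apply/seteqP; split => z /=;
    by rewrite in_itv/= andbT subr_ge0.
pose f (z : T * GR) := (s * expR (- s * z.2) * \1_A z)%:E.
have mf : measurable_fun setT f.
  apply/measurable_EFinP; apply: measurable_funM; last exact: measurable_indic.
  apply: measurable_funM => //.
  by apply: (measurableT_comp (measurable_expRM (- s))).
have f0 z : (0 <= f z)%E.
  by rewrite lee_fin !mulr_ge0 ?expR_ge0// ltW.
have fE t : (\int[P]_w f (w, t) =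
    (s * expR (- s * t))%:E * P [set w | X w <= t]%R)%E.
  rewrite (eq_integral (fun w =>
    (s * expR (- s * t))%:E * (\1_[set w | X w <= t] w)%:E)%E); last first.
    by move=> w _; rewrite /f EFinM !indicE.
  rewrite ge0_integralZl//; last 2 first.
    by apply/measurable_EFinP/measurable_indic; exact: measurable_le_rv.
    by rewrite lee_fin mulr_ge0 ?expR_ge0// ltW.
  by rewrite integral_indic ?setIT//; exact: measurable_le_rv.
have mG := @measurable_fun_fubini_tonelli_G _ _ T GR R P f mf f0.
have := @fubini_tonelli _ _ T GR R P mu f mf f0.
under eq_integral => w _.
  rewrite (_ : (fun y => f (w, y)) =
    (fun t => (s * expR (- s * t))%:E) \_ `[X w, +oo[); last first.
    apply/funext => t; rewrite patchE mem_setE in_itv/= andbT /f indicE.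
    case: ifPn => h; first by rewrite mem_set ?mulr1.
    by rewrite memNset ?mulr0//=; exact/negP.
  rewrite -integral_mkcond integral_expR_tail//.
  over.
move=> ->.
rewrite integral_itv_obnd_cbnd; last first.
  apply: measurable_funTS; apply: eq_measurable_fun mG => t _.
  by rewrite /fubini_G fE.
rewrite [LHS]integral_mkcond; apply: eq_integral => t _.
rewrite patchE mem_setE in_itv/= andbT fE; case: ifPn => //.
rewrite -ltNge => t0; rewrite (_ : [set w | X w <= t] = set0) ?measure0 ?mule0//.
apply/seteqP; split => w //=; apply/negP; rewrite -ltNge.
exact: lt_le_trans t0 (X0 w).
Qed.

Definition cdfR (X : T -> R) (t : R) : R := fine (P [set w | X w <= t]).

Lemma cdfRE X t : measurable_fun setT X -> (cdfR X t)%:E = P [set w | X w <= t].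
Proof.
by move=> mX; rewrite /cdfR fineK// fin_num_measure//; exact: measurable_le_rv.
Qed.

Lemma measurable_cdfR X : measurable_fun setT X ->
  measurable_fun setT (cdfR X).
Proof.
move=> mX; apply: nondecreasing_measurable => // x y xy.
rewrite -lee_fin !cdfRE//; apply: le_measure; rewrite ?inE.
- exact: measurable_le_rv.
- exact: measurable_le_rv.
- by move=> w /= /le_trans; exact.
Qed.

Lemma cdfR_itv X t : measurable_fun setT X -> 0 <= cdfR X t <= 1.
Proof.
move=> mX; rewrite -!lee_fin cdfRE// measure_ge0/= probability_le1//.
exact: measurable_le_rv.
Qed.

Lemma integrable_cdfR (X : T -> R) (s : R) : measurable_fun setT X -> 0 < s ->
  mu.-integrable `]0, +oo[ (EFin \o (fun t => expR (- s * t) * cdfR X t)).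
Proof.
move=> mX s0; apply: le_integrable_R (integrable_expRN s0) => //.
  apply: measurable_funTS; apply: measurable_funM; last exact: measurable_cdfR.
  exact: measurable_expRM.
move=> t _; have /andP[c0 c1] := cdfR_itv t mX.
by rewrite ger0_norm ?mulr_ge0 ?expR_ge0// ler_piMr ?expR_ge0.
Qed.

Lemma laplace_cdfR (X : T -> R) (s c : R) : measurable_fun setT X ->
  (forall w, 0 <= X w) -> 0 < s ->
  (\int[P]_w (expR (- s * X w))%:E = c%:E)%E ->
  \int[mu]_(t in `]0, +oo[) (expR (- s * t) * cdfR X t) = s^-1 * c.
Proof.
move=> mX X0 s0 Ec; apply: (mulfI (lt0r_neq0 s0)).
rewrite mulrA mulfV ?gt_eqF// mul1r -RintegralZl//; last exact: integrable_cdfR.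
rewrite /Rintegral -[RHS]/(fine c%:E) -Ec -(laplace_cdf_ereal mX X0 s0).
by congr fine; apply: eq_integral => t _; rewrite -cdfRE// -EFinM mulrA.
Qed.

End laplace_of_cdf.

(** * Inverses of nondecreasing processes *)

Section inverse_of_nondecreasing.
Context {d : measure_display} {T : measurableType d} {R : realType}.
Variable D : R -> T -> R.
Hypothesis D_nd : forall s t w, 0 <= s -> s <= t -> D s w <= D t w.
Local Notation Y := (inverse_process D).
Implicit Types (t x : R) (w : T).

Let lb0 t w : has_lbound [set x | 0 <= x /\ t < D x w].
Proof. by exists 0 => x [-> _]. Qed.

Lemma inverse_process_ge0 t w : 0 <= Y t w.
Proof.
have [E|/set0P ne] := eqVneq [set x | 0 <= x /\ t < D x w] set0.
  by rewrite /inverse_process E inf0.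
by apply: lb_le_inf => // x [].
Qed.

Lemma inverse_process_le t x w : 0 <= x -> t < D x w -> Y t w <= x.
Proof. by move=> x0 tD; apply: ge_inf. Qed.

Lemma inverse_process_ge t x w : (exists2 y, 0 <= y & t < D y w) ->
  D x w <= t -> x <= Y t w.
Proof.
move=> [y y0 ty] Dx; apply: lb_le_inf; first by exists y.
move=> z [z0 tz]; rewrite leNgt; apply/negP => zx.
by have := lt_le_trans tz (le_trans (D_nd w z0 (ltW zx)) Dx); rewrite ltxx.
Qed.

Lemma inverse_process_homo t t' w : (exists2 y, 0 <= y & t' < D y w) ->
  t <= t' -> Y t w <= Y t' w.
Proof.
move=> [y y0 ty] tt'; apply: lb_le_inf; first by exists y.
by move=> z [z0 tz]; apply: ge_inf => //; split => //; exact: le_lt_trans tz.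
Qed.

(** Y t w < x holds when t is exceeded before x, and by monotonicity this is
    detected at a sequence of times increasing to x; on the event where D never
    exceeds t the infimum is that of the empty set, namely 0. *)
Lemma measurable_inverse_process t :
  (forall x, 0 <= x -> measurable_fun setT (D x)) -> measurable_fun setT (Y t).
Proof.
move=> mD; have mgt x : 0 <= x -> measurable [set w | t < D x w].
  move=> x0; have := mD _ x0 measurableT `]t, +oo[%classic (measurable_itv _).
  rewrite setTI; congr measurable.
  by apply/seteqP; split => w /=; rewrite in_itv/= andbT.
pose bdd := [set w | forall n : nat, D n%:R w <= t].
have m_bdd : measurable bdd.
  rewrite (_ : bdd = \bigcap_(n in setT) ~` [set w | t < D n%:R w]).
    by apply: bigcapT_measurable => n; apply: measurableC; exact: mgt.
  apply/seteqP; split => w /=.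
    by move=> h n _ /=; apply/negP; rewrite -leNgt.
  by move=> h n; have := h n I => /= /negP; rewrite -leNgt.
move=> _; apply: (measurability _ (RGenInftyO.measurableE R)) => //.
move=> _ [_ [x ->] <-]; rewrite setTI.
have [x0|x0] := leP x 0.
  rewrite [X in measurable X](_ : _ = set0)//; apply/seteqP; split => w //=.
  rewrite in_itv/= => h; have := lt_le_trans h x0.
  by rewrite ltNge inverse_process_ge0.
pose u (n : nat) := x * (n%:R / n.+1%:R).
have u_ge0 n : 0 <= u n by rewrite mulr_ge0 ?(ltW x0)// divr_ge0.
have u_lt n : u n < x by rewrite gtr_pMr// ltr_pdivrMr// mul1r ltr_nat.
rewrite [X in measurable X](_ : _ = bdd `|` \bigcup_n [set w | t < D (u n) w]).
  apply: measurableU => //; apply: bigcupT_measurable => n; exact: mgt.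
apply/seteqP; split => w /=; rewrite in_itv/=.
- move=> Yx; have [bw|nb] := pselect (bdd w); [by left|right].
  have ne : [set x | 0 <= x /\ t < D x w] !=set0.
    move/existsNP : nb => [n /negP]; rewrite -ltNge => tn.
    by exists n%:R; split.
  have [y [y0 ty] yx] := inf_lt ne Yx.
  have xy0 : 0 < x - y by rewrite subr_gt0.
  exists (Num.truncn (x / (x - y))) => //=.
  apply: lt_le_trans ty _; apply: D_nd => //.
  have := truncnS_gt (x / (x - y)); rewrite /u; set n := Num.truncn _.
  rewrite ltr_pdivrMr// => h.
  by rewrite mulrA ler_pdivlMr// -natr1 in h *; lra.
- case=> [bw|[n _ /= tn]]; last first.
    exact: le_lt_trans (inverse_process_le (u_ge0 n) tn) (u_lt n).
  rewrite /inverse_process [X in inf X](_ : _ = set0) ?inf0//.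
  apply/seteqP; split => z //= -[z0 tz].
  have := bw (Num.truncn z).+1; rewrite leNgt => /negP; apply.
  apply: lt_le_trans tz _; apply: D_nd => //.
  by rewrite ltW// truncnS_gt.
Qed.

(** A discretisation of exp(- u Y) by an expression linear in the indicators of
    D (i delta) <= t, whose expectations are distribution functions.  If N is the
    first index with t < D (N delta), then Y lies between (N - 1) delta and
    N delta, so q ^+ N with q = exp(- u delta) is exp(- u Y) up to a factor
    between q and 1. *)
Lemma geometric_sum_indic (u delta q t : R) w K :
  q = expR (- (u * delta)) -> 0 <= u -> 0 < delta ->
  (exists2 y, 0 <= y & t < D y w) ->
  q * expR (- u * Y t w) <=
    1 - (1 - q) * \sum_(i < K) q ^+ i * \1_[set w | D (i%:R * delta) w <= t] w
  <= expR (- u * Y t w) + q ^+ K.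
Proof.
move=> q_def u0 d0 ne.
have q0 : 0 <= q by rewrite q_def expR_ge0.
have qE N : q ^+ N = expR (- u * (N%:R * delta)).
  by rewrite q_def -expRM_natl; congr expR; ring.
set W := 1 - _.
have eY0 : 0 <= expR (- u * Y t w) := expR_ge0 _.
have lower N : (forall i : nat, (i < N)%N -> D (i%:R * delta) w <= t) ->
    q * expR (- u * Y t w) <= q ^+ N.
  case: N => [_|N H].
    rewrite expr0 mulr_ile1//.
      by rewrite q_def -[leRHS]expR0 ler_expR oppr_le0 mulr_ge0// ltW.
    rewrite -[leRHS]expR0 ler_expR mulNr oppr_le0 mulr_ge0//.
    exact: inverse_process_ge0.
  rewrite exprS ler_wpM2l// qE ler_expR !mulNr lerN2 ler_wpM2l//.
  by apply: inverse_process_ge => //; exact: H.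
(* N is the first index with t < D (N delta); W is q ^+ N if N <= K, and q ^+ K
   otherwise, because the sum telescopes. *)
have {}WE : (W = q ^+ K /\
     forall i : nat, (i < K)%N -> D (i%:R * delta) w <= t) \/
   (exists N, [/\ (N <= K)%N, W = q ^+ N, t < D (N%:R * delta) w &
     forall i : nat, (i < N)%N -> D (i%:R * delta) w <= t]).
  rewrite /W; elim: K {W} => [|K [[IH H]|[N [NK IH tN H]]]].
  - by left; split => //; rewrite big_ord0 mulr0 subr0 expr0.
  - rewrite big_ord_recr/= indicE.
    have [DK|DK] := leP (D (K%:R * delta) w) t.
      left; split; last first.
        by move=> i; rewrite ltnS leq_eqVlt => /predU1P[->//|]; exact: H.
      by rewrite mem_set// mulr1 exprS; move: IH; lra.
    right; exists K; split => //; rewrite memNset ?mulr0 ?addr0//=.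
    by apply/negP; rewrite -ltNge.
  - right; exists N; rewrite big_ord_recr/= indicE.
    split => //; first exact: leqW.
    rewrite memNset ?mulr0 ?addr0//=; apply/negP; rewrite -ltNge.
    apply: lt_le_trans tN _; apply: D_nd; first by rewrite mulr_ge0// ltW.
    by rewrite ler_wpM2r ?(ltW d0)// ler_nat.
have {WE} [[-> H]|[N [_ -> tN H]]] := WE.
  by rewrite lower//= lerDr.
rewrite lower//=; apply: ler_wpDr; first exact: exprn_ge0.
rewrite qE ler_expR !mulNr lerN2 ler_wpM2l//.
by apply: inverse_process_le => //; rewrite mulr_ge0// ltW.
Qed.

End inverse_of_nondecreasing.

(** * The inverse stable subordinator *)

(** As delta tends to 0, q (1 - r) / (1 - q r) with q = exp(- u delta) and
    r = exp(- L delta) tends to L / (u + L).  Here h lies between this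
    quotient and its multiple by 1 / q, and the bounds on q and r come from
    1 - x <= exp(- x) <= 1 / (1 + x); the conclusion is an explicit error of order
    delta. *)
Lemma resolvent_squeeze (R : realType) (L u delta q r h : R) :
  0 < L -> 0 < u -> 0 < delta -> q * r < 1 -> r < 1 ->
  1 - delta * (u + L) <= q * r -> q * r <= (1 + delta * (u + L))^-1 ->
  1 - delta * L <= r -> r <= (1 + delta * L)^-1 -> 1 - u * delta <= q -> 0 < q ->
  h * (1 - q * r) <= 1 - r -> q * (1 - r) <= h * (1 - q * r) ->
  h <= L / (u + L) + delta * L /\
  (1 - delta * u) * (L / (u + L)) <= h * (1 + delta * L).
Proof.
move=> L0 u0 d0 qr1 r1 qr_lb qr_ub r_lb r_ub q_lb q0 lo hi.
have uL0 : 0 < u + L by rewrite addr_gt0.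
have c0 : 0 < delta * (u + L) by rewrite mulr_gt0.
have dL0 : 0 < delta * L by rewrite mulr_gt0.
have qr_gap : delta * (u + L) / (1 + delta * (u + L)) <= 1 - q * r.
  rewrite [leLHS](_ : _ = 1 - (1 + delta * (u + L))^-1); first lra.
  by field; rewrite gt_eqF//= addr_gt0.
have r_gap : delta * L / (1 + delta * L) <= 1 - r.
  rewrite [leLHS](_ : _ = 1 - (1 + delta * L)^-1); first lra.
  by field; rewrite gt_eqF//= addr_gt0.
have h0 : 0 <= h.
  rewrite -(pmulr_lge0 _ (_ : 0 < 1 - q * r)) ?subr_gt0//.
  by apply: le_trans hi; rewrite mulr_ge0 ?subr_ge0// ltW.
split.
  rewrite [leRHS](_ : _ = delta * L / (delta * (u + L) / (1 + delta * (u + L)))).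
    rewrite ler_pdivlMr ?divr_gt0 ?addr_gt0//.
    by apply: le_trans (ler_wpM2l h0 qr_gap) _; lra.
  by field; rewrite !gt_eqF//= addr_gt0.
have [neg|pos] := leP (1 - delta * u) 0.
  apply: (@le_trans _ _ 0); last by rewrite mulr_ge0// addr_ge0// ltW.
  by apply: mulr_le0_ge0 => //; rewrite divr_ge0// ltW.
have h1 : (1 - delta * u) * (delta * L / (1 + delta * L)) <= h * (delta * (u + L)).
  apply: (@le_trans _ _ (q * (1 - r))).
    apply: ler_pM; [exact: ltW| |by rewrite mulrC|exact: r_gap].
    by rewrite divr_ge0// ltW// addr_gt0.
  by apply: le_trans hi _; rewrite ler_wpM2l//; lra.
have k0 : 0 < delta * (u + L) / (1 + delta * L) by rewrite divr_gt0// addr_gt0.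
rewrite -(ler_pM2r k0) [leRHS](_ : _ = h * (delta * (u + L))); last first.
  by field; rewrite gt_eqF//= addr_gt0.
apply: le_trans h1; rewrite le_eqVlt; apply/orP; left; apply/eqP.
by field; rewrite !gt_eqF//= addr_gt0.
Qed.

Section inverse_stable_subordinator.
Context {d : measure_display} {T : measurableType d} {R : realType}.
Variables (P : probability T R) (beta : R) (D : R -> T -> R).
Hypothesis beta_gt0 : 0 < beta.
Hypothesis hD : stable_subordinator P beta D.
Local Notation mu := (@lebesgue_measure R).
Local Notation Y := (inverse_process D).

Let D0 w : D 0 w = 0. Proof. exact: levy_start (stable_levy hD) w. Qed.

Let D_nd s t w : 0 <= s -> s <= t -> D s w <= D t w.
Proof. exact: (stable_nondecreasing hD). Qed.

Let D_ge0 t w : 0 <= t -> 0 <= D t w.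
Proof. by move=> t0; rewrite -(D0 w) D_nd. Qed.

Let mD t : 0 <= t -> measurable_fun setT (D t).
Proof. by move=> t0; exact: (levy_measurable (stable_levy hD) t0). Qed.

Lemma measurable_inverse_stable t : measurable_fun setT (Y t).
Proof. by apply: measurable_inverse_process => // s t0 w; exact: D_nd. Qed.

Let laplace_D s x : 0 < s -> 0 <= x ->
  (\int[P]_w (expR (- s * D x w))%:E = (expR (- x * s `^ beta))%:E)%E.
Proof.
move=> s0 x0; have := stable_laplace hD s0 x0; by rewrite unlock.
Qed.

(** Chernoff's bound at the exponent 1, where E exp(- D(n)) = exp(- n). *)
Let cdf_bound (m n : nat) : cdfR P (D n%:R) m%:R <= expR (m%:R - n%:R).
Proof.
have mDn := mD (ler0n R n).
rewrite expRD mulrC -ler_pdivrMr ?expR_gt0// -expRN mulrC.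
have E : \int[P]_w expR (- 1 * D n%:R w) = expR (- n%:R).
  by rewrite /Rintegral laplace_D//= powR1 mulr1.
rewrite -E /cdfR -Rintegral_indic_prob; last exact: measurable_le_rv.
have mI : measurable_fun setT (\1_[set w | D n%:R w <= m%:R] : T -> R).
  by apply: measurable_indic; exact: measurable_le_rv.
have iI : P.-integrable setT (EFin \o (\1_[set w | D n%:R w <= m%:R] : T -> R)).
  apply: (@integrable_bounded_prob _ _ _ P _ 1) => // w.
  by rewrite indicE; case: (_ \in _); rewrite ?normr1 ?normr0.
rewrite -RintegralZl//; apply: le_Rintegral => //.
- exact: integrable_scale.
- apply: (@integrable_bounded_prob _ _ _ P _ 1).
    by apply: (measurableT_comp (measurable_expRM (-1))).
  move=> w; rewrite ger0_norm ?expR_ge0// -[leRHS]expR0 ler_expR mulN1r oppr_le0.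
  exact: D_ge0.
- move=> w _; rewrite indicE; case: (boolP (_ \in _)); last by rewrite mulr0 expR_ge0.
  by rewrite inE/= mulr1 ler_expR mulN1r lerN2.
Qed.

(** Off this null event the sets whose infimum defines the inverse process are
    nonempty. *)
Lemma stable_unbounded_ae :
  {ae P, forall w, forall t, exists2 y, 0 <= y & t < D y w}.
Proof.
have h : {ae P, forall w, forall m : nat, exists n : nat, m%:R < D n%:R w}.
  apply: ae_foralln => m.
  pose N := \bigcap_(n in setT) [set w | D n%:R w <= m%:R].
  have mN : measurable N.
    by apply: bigcapT_measurable => n; apply: measurable_le_rv; exact: mD.
  exists N; split => //; last first.
    move=> w /= h n _ /=; rewrite leNgt; apply/negP => mn; apply: h.
    by exists n.
  apply/eqP; rewrite eq_le measure_ge0 andbT.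
  apply/lee_addgt0Pr => e e0; rewrite add0e.
  (* Chosen so that exp(m - n) <= e, using n + 1 <= exp n. *)
  pose n := Num.truncn (expR m%:R / e).
  have mDn : measurable [set w | D n%:R w <= m%:R].
    by apply: measurable_le_rv; exact: mD.
  apply: (@le_trans _ _ (P [set w | D n%:R w <= m%:R])).
    by apply: le_measure; rewrite ?inE// => w /(_ n I).
  rewrite -cdfRE; last exact: mD.
  rewrite lee_fin; apply: le_trans (cdf_bound m n) _.
  rewrite expRD expRN ler_pdivrMr ?expR_gt0//.
  have := truncnS_gt (expR m%:R / e); rewrite -/n ltr_pdivrMr// mulrC => /ltW.
  move=> /le_trans; apply; rewrite ler_pM2l//.
  by apply: le_trans (expR_ge1Dx _); rewrite -natr1 addrC.
apply: filterS h => w h t.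
have [n tn] := h (Num.truncn t).+1; exists n%:R => //.
by apply: lt_trans tn; exact: truncnS_gt.
Qed.

Definition laplace_inverse (u t : R) : R := \int[P]_w expR (- u * Y t w).

Let Y_ge0 t w : 0 <= Y t w. Proof. exact: inverse_process_ge0. Qed.

Let expY_itv u t w : 0 <= u -> 0 <= expR (- u * Y t w) <= 1.
Proof.
move=> u0; rewrite expR_ge0/= -[leRHS]expR0 ler_expR mulNr oppr_le0.
by rewrite mulr_ge0.
Qed.

Lemma integrable_expR_inverse u t : 0 <= u ->
  P.-integrable setT (EFin \o (fun w => expR (- u * Y t w))).
Proof.
move=> u0; apply: (@integrable_bounded_prob _ _ _ P _ 1).
  apply: (measurableT_comp (measurable_expRM (- u))).
  exact: measurable_inverse_stable.
by move=> w; have /andP[? ?] := expY_itv t w u0; rewrite ger0_norm.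
Qed.

Lemma laplace_inverse_itv u t : 0 <= u -> 0 <= laplace_inverse u t <= 1.
Proof.
move=> u0; apply/andP; split.
  by apply: Rintegral_ge0 => w _; exact: expR_ge0.
apply: (@le_trans _ _ (\int[P]_w cst 1 w)).
  apply: le_Rintegral => //; first exact: integrable_expR_inverse.
    exact: finite_measure_integrable_cst.
  by move=> w _; have /andP[] := expY_itv t w u0.
by rewrite Rintegral_cst_prob.
Qed.

Lemma laplace_inverse_nonincreasing u : 0 <= u ->
  {homo laplace_inverse u : x y /~ x <= y}.
Proof.
move=> u0 x y xy; apply: le_Rintegral_ae => //.
- exact: integrable_expR_inverse.
- exact: integrable_expR_inverse.
- apply: filterS stable_unbounded_ae => w H _.
  rewrite ler_expR !mulNr lerN2 ler_wpM2l//.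
  by apply: inverse_process_homo.
Qed.

Lemma measurable_laplace_inverse u : 0 <= u ->
  measurable_fun setT (laplace_inverse u).
Proof.
move=> u0; rewrite (_ : laplace_inverse u = \- (fun t => - laplace_inverse u t)).
  apply: measurable_funN; apply: nondecreasing_measurable => // x y xy.
  by rewrite lerN2; exact: laplace_inverse_nonincreasing.
by apply/funext => t /=; rewrite opprK.
Qed.

Lemma integrable_laplace_inverse u s : 0 <= u -> 0 < s ->
  mu.-integrable `]0, +oo[ (EFin \o (fun t => expR (- s * t) * laplace_inverse u t)).
Proof.
move=> u0 s0; apply: le_integrable_R (integrable_expRN s0) => //.
  apply: measurable_funTS; apply: measurable_funM; first exact: measurable_expRM.
  exact: measurable_laplace_inverse.
move=> t _; have /andP[c0 c1] := laplace_inverse_itv t u0.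
by rewrite ger0_norm ?mulr_ge0 ?expR_ge0// ler_piMr ?expR_ge0.
Qed.

(** The expectation of the discretisation of exp(- u Y t). *)
Let geometric_cdf (q delta : R) (K : nat) (t : R) : R :=
  1 - (1 - q) * \sum_(i < K) q ^+ i * cdfR P (D (i%:R * delta)) t.

Let idelta_ge0 i (delta : R) : 0 < delta -> 0 <= i%:R * delta.
Proof. by move=> d0; rewrite mulr_ge0// ltW. Qed.

Let geometric_cdf_bounds (u delta q t : R) K :
  q = expR (- (u * delta)) -> 0 <= u -> 0 < delta ->
  q * laplace_inverse u t <= geometric_cdf q delta K t
    <= laplace_inverse u t + q ^+ K.
Proof.
move=> qE u0 d0.
have q0 : 0 <= q by rewrite qE expR_ge0.
pose I i w : R := \1_[set w | D (i%:R * delta) w <= t] w.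
have mI i : measurable [set w | D (i%:R * delta) w <= t].
  by apply: measurable_le_rv; apply: mD; exact: idelta_ge0.
have iI i : P.-integrable setT (EFin \o (fun w => q ^+ i * I i w)).
  apply: integrable_scale => //; apply: (@integrable_bounded_prob _ _ _ P _ 1).
    exact: measurable_indic.
  by move=> w; rewrite /I indicE; case: (_ \in _); rewrite ?normr1 ?normr0.
have isum := integrable_Rsum (index_enum 'I_K) measurableT (fun i : 'I_K => iI i).
have icst c : P.-integrable setT (EFin \o cst c).
  exact: finite_measure_integrable_cst.
pose W w := 1 - (1 - q) * \sum_(i < K) q ^+ i * I i w.
have iW : P.-integrable setT (EFin \o W).
  by have := integrable_sub measurableT (icst 1)
    (integrable_scale (1 - q) measurableT isum).
have EW : \int[P]_w W w = geometric_cdf q delta K t.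
  rewrite /W (@RintegralB _ _ _ P setT (cst 1))//; last first.
    exact: (integrable_scale (1 - q) measurableT isum).
  rewrite Rintegral_cst_prob; congr (_ - _).
  rewrite RintegralZl// Rintegral_sum//; congr (_ * _); apply: eq_bigr => i _.
  rewrite RintegralZl//; first by rewrite Rintegral_indic_prob.
  apply: (@integrable_bounded_prob _ _ _ P _ 1); first exact: measurable_indic.
  by move=> w; rewrite /I indicE; case: (_ \in _); rewrite ?normr1 ?normr0.
have bnd : {ae P, forall w, q * expR (- u * Y t w) <= W w <= expR (- u * Y t w) + q ^+ K}.
  apply: filterS stable_unbounded_ae => w H.
  by apply: geometric_sum_indic.
have ieY := integrable_expR_inverse t u0.
have iqY : P.-integrable setT (EFin \o (fun w => q * expR (- u * Y t w))).
  exact: integrable_scale.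
have iYq : P.-integrable setT (EFin \o (fun w => expR (- u * Y t w) + q ^+ K)).
  have := integrableD measurableT ieY (icst (q ^+ K)).
  by apply: eq_integrable => // w _ /=; rewrite EFinD.
rewrite /laplace_inverse -RintegralZl// -EW.
rewrite -[X in _ + X](Rintegral_cst_prob P) -RintegralD//.
by apply/andP; split; apply: le_Rintegral_ae => //;
  apply: filterS bnd => w /andP[].
Qed.

Let laplace_cdf_D s x : 0 < s -> 0 <= x ->
  \int[mu]_(t in `]0, +oo[) (expR (- s * t) * cdfR P (D x) t) =
  s^-1 * expR (- x * s `^ beta).
Proof.
move=> s0 x0; apply: laplace_cdfR => //; first exact: mD.
  by move=> w; exact: D_ge0.
exact: laplace_D.
Qed.

Let integrable_geometric_cdf s q delta K : 0 < s -> 0 < delta ->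
  mu.-integrable `]0, +oo[
    (EFin \o (fun t => \sum_(i < K)
      q ^+ i * (expR (- s * t) * cdfR P (D (i%:R * delta)) t))).
Proof.
move=> s0 d0; apply: integrable_Rsum => // i.
have mDi : measurable_fun setT (D (i%:R * delta)) by apply: mD; exact: idelta_ge0.
by have /(_ (measurable_itv _)) := integrable_scale (q ^+ i) _ (integrable_cdfR P mDi s0).
Qed.

Let geometric_cdfE s q delta K t :
  expR (- s * t) * geometric_cdf q delta K t =
  expR (- s * t) - (1 - q) *
    \sum_(i < K) q ^+ i * (expR (- s * t) * cdfR P (D (i%:R * delta)) t).
Proof.
rewrite /geometric_cdf mulrBr mulr1; congr (_ - _).
rewrite mulrCA; congr (_ * _); rewrite mulr_sumr; apply: eq_bigr => i _.
by rewrite mulrCA.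
Qed.

Let laplace_geometric_cdf s q delta K : 0 < s -> 0 < delta ->
  mu.-integrable `]0, +oo[
    (EFin \o (fun t => expR (- s * t) * geometric_cdf q delta K t)) /\
  \int[mu]_(t in `]0, +oo[) (expR (- s * t) * geometric_cdf q delta K t) =
  s^-1 * (1 - (1 - q) * series (geometric 1 (q * expR (- delta * s `^ beta))) K).
Proof.
move=> s0 d0; have isum := integrable_geometric_cdf q K s0 d0.
have ie := integrable_expRN s0.
have /(_ (measurable_itv _)) isum' := integrable_scale (1 - q) _ isum.
split.
  have /(_ (measurable_itv _)) := integrable_sub _ ie isum'.
  by apply: eq_integrable => // t _ /=; rewrite geometric_cdfE.
under eq_Rintegral do rewrite geometric_cdfE.
rewrite RintegralB// RintegralZl// Rintegral_sum//; last first.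
  move=> i.
  have mDi : measurable_fun setT (D (i%:R * delta)) by apply: mD; exact: idelta_ge0.
  by have /(_ (measurable_itv _)) := integrable_scale (q ^+ i) _ (integrable_cdfR P mDi s0).
rewrite Rintegral_expRN// mulrBr mulr1; congr (_ - _).
rewrite mulrCA; congr (_ * _); rewrite /series/= big_mkord mulr_sumr.
apply: eq_bigr => i _.
have mDi : measurable_fun setT (D (i%:R * delta)) by apply: mD; exact: idelta_ge0.
rewrite RintegralZl//; last exact: integrable_cdfR.
rewrite laplace_cdf_D ?idelta_ge0// mulrCA mul1r exprMn -expRM_natl.
by congr (_ * (_ * expR _)); ring.
Qed.

(** Transform the discretisation: the distribution function of D (i delta) has
    transform s^(-1) exp(- i delta s^beta), so the sums over i become geometric.
    Letting first K tend to infinity, then delta to 0, leaves s^beta / (u + s^beta)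
    for s times the transform. *)
Lemma laplace_laplace_inverse u s : 0 < u -> 0 < s ->
  \int[mu]_(t in `]0, +oo[) (expR (- s * t) * laplace_inverse u t) =
  s^-1 * (1 + u / s `^ beta)^-1.
Proof.
move=> u0 s0.
set H := \int[mu]_(t in _) _; pose L := s `^ beta.
have L0 : 0 < L by exact: powR_gt0.
have iH := integrable_laplace_inverse (ltW u0) s0.
have sand delta K : 0 < delta ->
   let q := expR (- (u * delta)) in let r := expR (- delta * L) in
   (q * (s * H) <= 1 - (1 - q) * series (geometric 1 (q * r)) K) /\
   (1 - (1 - q) * series (geometric 1 (q * r)) K <= s * H + q ^+ K).
  move=> d0 q r.
  have [ig gE] := laplace_geometric_cdf q K s0 d0.
  have bnd t := @geometric_cdf_bounds u delta q t K erefl (ltW u0) d0.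
  have ie := integrable_expRN s0.
  have h1 : q * H <= \int[mu]_(t in `]0, +oo[) (expR (- s * t) * geometric_cdf q delta K t).
    rewrite /H -RintegralZl//; apply: le_Rintegral => //.
      by have /(_ (measurable_itv _)) := integrable_scale q _ iH.
    move=> t _; have /andP[+ _] := bnd t.
    by rewrite mulrCA; apply: ler_wpM2l; exact: expR_ge0.
  have h2 : \int[mu]_(t in `]0, +oo[) (expR (- s * t) * geometric_cdf q delta K t)
      <= H + q ^+ K * s^-1.
    rewrite /H -(Rintegral_expRN s0) -RintegralZl// -RintegralD//; last first.
      by have /(_ (measurable_itv _)) := integrable_scale (q ^+ K) _ ie.
    apply: le_Rintegral => //.
      have /(_ (measurable_itv _)) iq := integrable_scale (q ^+ K) _ ie.
      have /(_ (measurable_itv _)) := integrableD _ iH iq.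
      by apply: eq_integrable => // t _ /=; rewrite EFinD.
    move=> t _; have /andP[_ +] := bnd t.
    rewrite [q ^+ K * _]mulrC -mulrDr.
    by apply: ler_wpM2l; exact: expR_ge0.
  rewrite gE in h1 h2; split.
    by rewrite mulrCA -ler_pdivlMl.
  have := ler_wpM2l (ltW s0) h2.
  by rewrite mulrA mulfV ?gt_eqF// mul1r mulrDr mulrCA mulfV ?gt_eqF// mulr1.
have q01 (c delta : R) : 0 < c -> 0 < delta -> 0 < expR (- (c * delta)) < 1.
  by move=> c0 d0; rewrite expR_gt0 -[ltRHS]expR0 ltr_expR oppr_lt0 mulr_gt0.
(* The limit K --> oo. *)
have lim delta : 0 < delta ->
   let q := expR (- (u * delta)) in let r := expR (- delta * L) in
   (q * (s * H) <= q * (1 - r) / (1 - q * r)) /\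
   (q * (1 - r) / (1 - q * r) <= s * H).
  move=> d0 q r.
  have /andP[q0 q1] : 0 < q < 1 by exact: q01.
  have /andP[r0 r1] : 0 < r < 1 by rewrite /r mulNr mulrC; exact: q01.
  have qr1 : q * r < 1 by rewrite mulr_ilt1// ltW.
  have aE : q * (1 - r) / (1 - q * r) = 1 - (1 - q) * (1 * (1 - q * r)^-1).
    by field; rewrite gt_eqF// subr_gt0.
  have qrN : `|q * r| < 1 by rewrite ger0_norm// mulr_ge0// ltW.
  have cX : 1 - (1 - q) * series (geometric 1 (q * r)) K @[K --> \oo] -->
      q * (1 - r) / (1 - q * r).
    rewrite aE; apply: cvgB; first exact: cvg_cst.
    by apply: cvgMr; exact: cvg_geometric_series.
  have cX' : 1 - (1 - q) * series (geometric 1 (q * r)) K - q ^+ K @[K --> \oo] -->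
      q * (1 - r) / (1 - q * r) - 0.
    by apply: cvgB => //; apply: cvg_expr; rewrite ger0_norm// ltW.
  split.
    rewrite -(cvg_lim _ cX)//; apply: limr_ge; first exact: cvgP cX.
    by apply: nearW => K; have [] := sand delta K d0.
  rewrite -[leLHS]subr0 -(cvg_lim _ cX')//; apply: limr_le; first exact: cvgP cX'.
  by apply: nearW => K; rewrite lerBlDr; have [] := sand delta K d0.
have main delta : 0 < delta ->
   s * H <= L / (u + L) + delta * L /\
   (1 - delta * u) * (L / (u + L)) <= s * H * (1 + delta * L).
  move=> d0; have := lim delta d0 => /=.
  have := q01 _ _ u0 d0; set q := expR _ => /andP[q0 q1].
  have : 0 < expR (- delta * L) < 1 by rewrite mulNr mulrC; exact: q01.
  set r := expR (- delta * L) => /andP[r0 r1] [lo hi].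
  have expN (x : R) : 0 < x -> expR (- x) <= (1 + x)^-1.
    move=> x0; rewrite expRN lef_pV2 ?posrE ?expR_gt0 ?expR_ge1Dx//.
    by rewrite addr_gt0.
  have qr1 : q * r < 1 by rewrite mulr_ilt1// ltW.
  have qrE : q * r = expR (- (delta * (u + L))).
    by rewrite -expRD; congr expR; ring.
  have c0 : 0 < delta * (u + L) by rewrite mulr_gt0// addr_gt0.
  have qr_ub := expN _ c0; rewrite -qrE in qr_ub.
  have qr_lb := expR_ge1Dx (- (delta * (u + L))); rewrite -qrE in qr_lb.
  have dL0 : 0 < delta * L by rewrite mulr_gt0.
  have r_ub := expN _ dL0; have r_lb := expR_ge1Dx (- (delta * L)).
  have rE : expR (- (delta * L)) = r by rewrite /r mulNr.
  rewrite rE in r_ub r_lb.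
  have q_lb := expR_ge1Dx (- (u * delta)); rewrite -/q in q_lb.
  rewrite -mulrA ler_pM2l// ler_pdivlMr ?subr_gt0// in lo.
  rewrite ler_pdivrMr ?subr_gt0// in hi.
  by apply: (@resolvent_squeeze _ L u delta q r (s * H)).
have uL0 : 0 < u + L by rewrite addr_gt0.
(* The limit delta --> 0. *)
have E : s * H = L / (u + L).
  apply/eqP; rewrite eq_le; apply/andP; split.
    apply/ler_addgt0Pr => e e0.
    have [+ _] := main (e / L) (divr_gt0 e0 L0).
    by rewrite divfK ?gt_eqF.
  apply/ler_addgt0Pr => e e0.
  have H0 : 0 <= s * H.
    rewrite mulr_ge0 ?(ltW s0)//; apply: Rintegral_ge0 => t _.
    rewrite mulr_ge0 ?expR_ge0//.
    by have /andP[] := laplace_inverse_itv t (ltW u0).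
  pose C := u * (L / (u + L)) + s * H * L + 1.
  have C0 : 0 < C.
    rewrite /C ltr_wpDl// addr_ge0// mulr_ge0 ?(ltW u0) ?(ltW L0)//.
    by rewrite divr_ge0 ?(ltW uL0)// ltW.
  have [_] := main (e / C) (divr_gt0 e0 C0).
  have : e / C * (u * (L / (u + L)) + s * H * L) <= e.
    rewrite mulrAC ler_pdivrMr// ler_wpM2l ?(ltW e0)// /C; lra.
  set l := L / (u + L); set a := e / C; nra.
apply: (mulfI (lt0r_neq0 s0)); rewrite E mulrA mulfV ?gt_eqF// mul1r.
rewrite -/L; field.
by rewrite ?(addrC L u) !gt_eqF.
Qed.

(** Both sides, as functions of t, have the same Laplace transform; the left one
    is nonincreasing since the inverse process increases with t. *)
Lemma inverse_stable_laplace u t : 0 < u -> 0 < t ->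
  \int[P]_w expR (- u * Y t w) = mittag_leffler beta 1 (- (u * t `^ beta)).
Proof.
(* Here s `^ beta = u + 1, so that u < (s + n) `^ beta for every n. *)
move=> u0 t0; pose s := (u + 1) `^ beta^-1.
have s0 : 0 < s by rewrite powR_gt0// addr_gt0.
have sn0 (n : nat) : 0 < s + n%:R by rewrite ltr_wpDr.
have sn (n : nat) : u < (s + n%:R) `^ beta.
  apply: (@lt_le_trans _ _ (s `^ beta)).
    rewrite /s -powRrM mulVf ?gt_eqF// powRr1; first by rewrite ltrDl.
    by rewrite addr_ge0// ltW.
  by rewrite ge0_ler_powR ?nnegrE ?(ltW beta_gt0) ?(ltW (sn0 _)) ?(ltW s0)// lerDl.
have u0' := ltW u0.
rewrite -/(laplace_inverse u t) -mulNr.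
have := @laplace_transform_inj_nonincreasing R (laplace_inverse u)
  (fun t => mittag_leffler beta 1 (- u * t `^ beta)) s (ltW s0).
apply => //.
- exact: laplace_inverse_nonincreasing.
- move=> x x0; apply: continuous_comp; last exact: mittag_leffler_continuous.
  apply: cvgM; first exact: cvg_cst.
  have : derivable (fun x : R => x `^ beta) x 1.
    by apply: derivable_powR; rewrite in_itv/= andbT.
  by move=> /derivable1_diffP/differentiable_continuous.
- exact: integrable_laplace_inverse.
- have := sn 0%N; rewrite addr0 => us.
  by have [] := laplace_mittag_leffler beta_gt0 u0' s0 us.
- move=> n; rewrite laplace_laplace_inverse//.
  by have [_ ->] := laplace_mittag_leffler beta_gt0 u0' (sn0 n) (sn n).
Qed.

End inverse_stable_subordinator.

(** * Exponential moments and their derivatives *)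

Section exponential_moments.
Context {d : measure_display} {T : measurableType d} {R : realType}.
Variables (P : probability T R) (Y : T -> R).
Hypothesis mY : measurable_fun setT Y.
Hypothesis Y0 : forall w, 0 <= Y w.

Definition exp_moment (m : nat) (u : R) : R :=
  \int[P]_w (Y w ^+ m * expR (- u * Y w)).

(** A single term of the exponential series, (c x)^m / m!, is at most exp(c x). *)
Lemma exprn_expR_bound (m : nat) (c x : R) : 0 < c -> 0 <= x ->
  x ^+ m * expR (- c * x) <= m`!%:R / c ^+ m.
Proof.
move=> c0 x0; case: m => [|m].
  rewrite !expr0 fact0 mul1r divr1 -[leRHS]expR0 ler_expR.
  by rewrite mulNr oppr_le0 mulr_ge0// ltW.
have cx0 : 0 <= c * x by rewrite mulr_ge0// ltW.
have := expR_ge1Dxn m cx0; rewrite exprMn => h.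
have fm0 : (0 : R) < m.+1`!%:R by rewrite ltr0n fact_gt0.
have cm0 : 0 < c ^+ m.+1 by rewrite exprn_gt0.
rewrite mulNr expRN ler_pdivrMr ?expR_gt0//.
rewrite [leLHS](_ : _ = m.+1`!%:R / c ^+ m.+1 *
  (c ^+ m.+1 * x ^+ m.+1 / m.+1`!%:R)); last by field; rewrite !gt_eqF.
apply: ler_wpM2l; first by rewrite divr_ge0// ltW.
by apply: le_trans h; rewrite lerDr.
Qed.

Let measurable_term m u : measurable_fun setT (fun w => Y w ^+ m * expR (- u * Y w)).
Proof.
apply: measurable_funM; first exact: measurable_funX.
by apply: (measurableT_comp (measurable_expRM (- u))).
Qed.

Lemma integrable_exp_moment m u : 0 < u ->
  P.-integrable setT (EFin \o (fun w => Y w ^+ m * expR (- u * Y w))).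
Proof.
move=> u0; apply: (@integrable_bounded_prob _ _ _ P _ (m`!%:R / u ^+ m)).
  exact: measurable_term.
move=> w; rewrite ger0_norm ?exprn_expR_bound//.
by rewrite mulr_ge0 ?exprn_ge0 ?expR_ge0.
Qed.

(** Differentiation under the integral on ]u / 2, 2 u[, where the derivative of
    the integrand is dominated by its value at u / 2. *)
Lemma is_derive_exp_moment m (u : R) : 0 < u ->
  is_derive u 1 (exp_moment m) (- exp_moment m.+1 u).
Proof.
move=> u0.
pose f (x : R) w := Y w ^+ m * expR (- x * Y w).
have df (x : R) w : is_derive x 1 (f ^~ w) (- (Y w ^+ m.+1 * expR (- x * Y w))).
  have -> : f ^~ w = Y w ^+ m \*: (fun x => expR (- Y w * x)).
    by apply/funext => z; rewrite /f /= mulrC -[RHS]mulrC !mulNr [z * _]mulrC.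
  have -> : - (Y w ^+ m.+1 * expR (- x * Y w)) =
      Y w ^+ m *: (- Y w * expR (- Y w * x)).
    rewrite /GRing.scale/= exprS [- x * _]mulrC mulrN -mulNr; ring.
  apply: is_deriveZ; exact: is_derive_expRM.
pose G w := Y w ^+ m.+1 * expR (- (u / 2) * Y w).
have u20 : 0 < u / 2 by rewrite divr_gt0.
have Iu : `]u / 2, u * 2[%classic u by rewrite /= in_itv/=; lra.
have intf x : `]u / 2, u * 2[%classic x -> P.-integrable setT (EFin \o f x).
  by rewrite /= in_itv/= => /andP[x0 _]; apply: integrable_exp_moment; lra.
have derf x w : `]u / 2, u * 2[%classic x -> [set: T] w -> derivable (f ^~ w) x 1.
  by move=> _ _; case: (df x w).
have G0 w : 0 <= G w by rewrite mulr_ge0 ?exprn_ge0 ?expR_ge0.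
have iG : P.-integrable setT (EFin \o G) by exact: integrable_exp_moment.
have Gub x w : `]u / 2, u * 2[%classic x -> [set: T] w ->
    `|partial1of2 f x w| <= G w.
  rewrite /= in_itv/= => /andP[x0 _] _; rewrite partial1of2E.
  have -> : 'D_1 (f^~ w) x = - (Y w ^+ m.+1 * expR (- x * Y w)) by case: (df x w).
  rewrite normrN ger0_norm ?mulr_ge0 ?exprn_ge0 ?expR_ge0//.
  by rewrite ler_wpM2l ?exprn_ge0// ler_expR !mulNr lerN2 ler_wpM2r// ltW.
have derF := derivable_under_integral measurableT Iu intf derf G0 iG Gub.
have DF := differentiation_under_integral measurableT Iu intf derf G0 iG Gub.
apply: DeriveDef; first exact: derF.
rewrite -derive1E DF -[RHS]mulN1r -RintegralZl//; last exact: integrable_exp_moment.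
apply: eq_Rintegral => w _; rewrite partial1of2E mulN1r.
by case: (df u w).
Qed.

End exponential_moments.

Section derivatives_at_reciprocal.
Context {R : realType}.
Variable F : nat -> R -> R.
Hypothesis dF : forall m (u : R), 0 < u -> is_derive u 1 (F m) (- F m.+1 u).
Variable Lambda : R.
Hypothesis Lambda0 : 0 < Lambda.

(** The space of these functions is stable under differentiation, and real
    exponents avoid the case distinction on the sign of a. *)
Let h (a : R) l (s : R) := s `^ a * F l (Lambda * s `^ (- 1)).

Let dh a l (s : R) : 0 < s ->
  is_derive s 1 (h a l) (a * h (a - 1) l s + Lambda * h (a - 2) l.+1 s).
Proof.
move=> s0.
have d1 : is_derive s 1 (Lambda \*: (fun s : R => s `^ (- 1)))
    (Lambda *: (- 1 * s `^ (- 1 - 1))).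
  by apply: is_deriveZ; exact: is_derive1_powR.
have u0 : 0 < Lambda * s `^ (- 1) by rewrite mulr_gt0// powR_gt0.
have d2 := @is_derive1_comp _ (F l) (Lambda \*: (fun s : R => s `^ (- 1))) s
  _ _ (dF l u0) d1.
have d3 := is_deriveM (is_derive1_powR a s0) d2.
apply: (is_derive_eq d3).
rewrite /h /= /GRing.scale/=.
have -> : s `^ (a - 2) = s `^ a * s `^ (- 1 - 1).
  by rewrite -powRD ?(gt_eqF s0) ?implybT//; congr (_ `^ _); ring.
ring.
Qed.

Variable z : nat.

(** The coefficient of F l in the i-th derivative, by the recurrence that the
    product rule gives. *)
Fixpoint reciprocal_coeff (i l : nat) : R :=
  if i is i'.+1 then
    (z%:R - 1 - i'%:R - l%:R) * reciprocal_coeff i' l +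
    (if l is l'.+1 then reciprocal_coeff i' l' else 0)
  else (l == 0%N)%:R.

(** The closed form shows that, for i = z and l < z, the factor r = z occurs in
    the product and kills the coefficient. *)
Lemma reciprocal_coeffE i l :
  reciprocal_coeff i l = 'C(i, l)%:R * \prod_(l.+1 <= r < i.+1) (z%:R - r%:R).
Proof.
elim: i l => [|i IH] l /=.
  by rewrite big_geq ?mulr1//; case: l.
case: l => [|l].
  rewrite IH !bin0 !mul1r addr0 subr0 [RHS]big_nat_recr//= mulrC.
  by congr (_ * _); rewrite -natr1; ring.
rewrite !IH binS; have [il|li|->] := ltngtP i l.
- by rewrite !bin_small ?mul0r ?mulr0 ?addr0// ltnW.
- rewrite [\prod_(l.+2 <= _ < i.+2) _]big_nat_recr//= [\prod_(l.+1 <= _ < _) _]big_ltn//.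
  have : l.+1%:R * 'C(i, l.+1)%:R = (i%:R - l%:R) * 'C(i, l)%:R :> R.
    by rewrite -natrM mul_bin_left natrM natrB// ltnW.
  rewrite natrD -[i.+1%:R]natr1 -[l.+1%:R]natr1.
  set A := 'C(i, l.+1)%:R; set B := 'C(i, l)%:R; set p := \prod_(_ <= _ < _) _.
  move=> E.
  have -> : (A + B) * (p * (z%:R - (i%:R + 1))) = p *
     ((z%:R - 1 - i%:R - (l%:R + 1)) * A + (z%:R - (l%:R + 1)) * B
      + ((l%:R + 1) * A - (i%:R - l%:R) * B)) by ring.
  by rewrite E; ring.
- by rewrite bin_small// binn !big_geq// mul0r mulr0 !add0r.
Qed.

Lemma derive1n_reciprocal i (s : R) : 0 < s ->
  derive1n i (fun s : R => s ^ (z%:Z - 1) * F 0 (Lambda / s)) s =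
  \sum_(l < i.+1) reciprocal_coeff i l * (Lambda ^+ l * h (z%:R - 1 - i%:R - l%:R) l s).
Proof.
elim: i s => [|i IH] s s0.
  rewrite /= big_ord1 /= !mul1r /h powR_inv1 ?(ltW s0)// !subr0.
  by rewrite -powR_intmul ?(ltW s0)// intrB.
rewrite derive1nS derive1E.
pose S (x : R) := \sum_(l < i.+1) reciprocal_coeff i l *
    (Lambda ^+ l * h (z%:R - 1 - i%:R - l%:R) l x).
rewrite (@near_eq_derive _ _ _ _ S); last first.
  have : \forall x \near s, 0 < x by exact: lt_nbhsr.
  by apply: filterS => x x0; exact: IH.
pose t l := h (z%:R - 1 - i.+1%:R - l%:R) l s.
have dS : is_derive s 1 S (\sum_(l < i.+1) reciprocal_coeff i l *
    (Lambda ^+ l * ((z%:R - 1 - i%:R - l%:R) * t l + Lambda * t l.+1))).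
  have -> : S = \sum_(l < i.+1) (reciprocal_coeff i l * Lambda ^+ l) \*:
      h (z%:R - 1 - i%:R - l%:R) l.
    apply/funext => x; rewrite /S fct_sumE; apply: eq_bigr => l _.
    by rewrite mulrA.
  apply: is_derive_sum => l.
  have := is_deriveZ (reciprocal_coeff i l * Lambda ^+ l)
    (dh (z%:R - 1 - i%:R - l%:R) l s0).
  rewrite (_ : _ *: _ = reciprocal_coeff i l *
    (Lambda ^+ l * ((z%:R - 1 - i%:R - l%:R) * t l + Lambda * t l.+1)))//.
  rewrite [LHS]/GRing.scale/= -mulrA /t; congr (_ * (_ * (_ * h _ _ _ + _ * h _ _ _)));
    by rewrite -!natr1; ring.
case: dS => _ ->.
rewrite (eq_bigr (fun l : 'I_i.+1 =>
   (z%:R - 1 - i%:R - l%:R) * reciprocal_coeff i l * (Lambda ^+ l * t l) +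
   reciprocal_coeff i l * (Lambda ^+ l.+1 * t l.+1))); last first.
  by move=> l _; rewrite exprS; ring.
rewrite big_split/=.
rewrite [RHS](eq_bigr (fun l : 'I_i.+2 =>
   (z%:R - 1 - i%:R - l%:R) * reciprocal_coeff i l * (Lambda ^+ l * t l) +
   (if (l : nat) is l'.+1 then reciprocal_coeff i l' else 0) * (Lambda ^+ l * t l)));
  last by move=> l _; rewrite mulrDl.
rewrite big_split/=; congr (_ + _).
  rewrite [RHS]big_ord_recr/= (reciprocal_coeffE i i.+1) bin_small//.
  by rewrite mul0r mulr0 mul0r addr0.
by rewrite [RHS]big_ord_recl/= mul0r add0r.
Qed.

Lemma derive1n_reciprocal_at1 :
  derive1n z (fun s : R => s ^ (z%:Z - 1) * F 0 (Lambda / s)) 1 =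
  Lambda ^+ z * F z Lambda.
Proof.
rewrite derive1n_reciprocal// big_ord_recr/= big1 ?add0r.
  rewrite reciprocal_coeffE binn big_geq// !mul1r /h powR1 mul1r.
  by rewrite mulr1.
move=> l _; rewrite reciprocal_coeffE big_nat_recr//= subrr mulr0 mulr0.
by rewrite mul0r.
Qed.

End derivatives_at_reciprocal.

(** The positive reals are open, so equality there passes to all derivatives. *)
Lemma eq_derive1n_gt0 (R : realType) (f g : R -> R) :
  (forall s, 0 < s -> f s = g s) ->
  forall i s, 0 < s -> derive1n i f s = derive1n i g s.
Proof.
move=> fg; elim=> [|i ih] s s0; first exact: fg.
rewrite !derive1nS !derive1E; apply: near_eq_derive.
have : \forall x \near s, 0 < x by exact: lt_nbhsr.
by apply: filterS => x; exact: ih.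
Qed.

(** * Uniqueness of convolution semigroups *)

Section convolution_semigroups.
Context {R : realType}.
Variable N : nat.

Lemma sum_coef_le_horner1 (p : {poly R}) :
  (forall i, 0 <= p`_i) -> \sum_(i < N) p`_i <= p.[1].
Proof.
move=> p0; rewrite (@horner_coef_wide _ (N + size p)); last exact: leq_addl.
rewrite big_split_ord/=; under [in leRHS]eq_bigr do rewrite expr1n mulr1.
by rewrite lerDl sumr_ge0// => i _; rewrite mulr_ge0// expr1n.
Qed.

(** A convolution is a product of polynomials; its first N coefficients sum to
    at most the value at 1 of the product. *)
Lemma sum_convolution_le (a b : nat -> R) :
  (forall i, 0 <= a i) -> (forall i, 0 <= b i) ->
  \sum_(m < N) \sum_(i < m.+1) a i * b (m - i)%N <=
  (\sum_(i < N) a i) * (\sum_(i < N) b i).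
Proof.
move=> a0 b0; pose pa := \poly_(i < N) a i; pose pb := \poly_(i < N) b i.
have hE (f : nat -> R) : (\poly_(i < N) f i).[1] = \sum_(i < N) f i.
  by rewrite horner_poly; apply: eq_bigr => i _; rewrite expr1n mulr1.
have := @sum_coef_le_horner1 (pa * pb); rewrite hornerM !hE.
move=> H; apply: le_trans (H _).
  apply: ler_sum => m _; rewrite coefM; apply: ler_sum => i _.
  have iN : (i < N)%N by rewrite (leq_ltn_trans _ (ltn_ord m))// -ltnS.
  have miN : (m - i < N)%N by rewrite (leq_ltn_trans (leq_subr _ _) (ltn_ord m)).
  by rewrite !coef_poly iN miN.
move=> i; rewrite coefM sumr_ge0// => j _; rewrite !coef_poly.
by case: ifP => _; case: ifP => _; rewrite ?mul0r ?mulr0 ?mulr_ge0.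
Qed.

(** The sums stop at N: the values below N form a semigroup of their own, because
    convolution on the naturals never looks above the current index. *)
Definition substochastic_semigroup (p : R -> nat -> R) :=
  [/\ forall t m, 0 <= t -> 0 <= p t m,
      forall t, 0 <= t -> \sum_(m < N) p t m <= 1 &
      forall s t m, 0 <= s -> 0 <= t -> (m < N)%N ->
        p (s + t) m = \sum_(i < m.+1) p s i * p t (m - i)%N].

Variables p q : R -> nat -> R.
Hypotheses (hp : substochastic_semigroup p) (hq : substochastic_semigroup q).

Let dist t := \sum_(m < N) `|p t m - q t m|.

Let dist_subadd s t : 0 <= s -> 0 <= t -> dist (s + t) <= dist s + dist t.
Proof.
have [p0 p1 pD] := hp; have [q0 q1 qD] := hq; move=> s0 t0.
apply: (@le_trans _ _ (\sum_(m < N)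
  (\sum_(i < m.+1) `|p s i - q s i| * q t (m - i)%N +
   \sum_(i < m.+1) p s i * `|p t (m - i)%N - q t (m - i)%N|))).
  apply: ler_sum => m _; rewrite pD// qD// -sumrB -big_split/=.
  apply: le_trans (ler_norm_sum _ _ _) _; apply: ler_sum => i _.
  have -> : p s i * p t (m - i)%N - q s i * q t (m - i)%N =
    (p s i - q s i) * q t (m - i)%N + p s i * (p t (m - i)%N - q t (m - i)%N).
    by ring.
  apply: le_trans (ler_normD _ _) _.
  by rewrite !normrM (ger0_norm (q0 _ _ t0)) (ger0_norm (p0 _ _ s0)).
rewrite big_split/=; apply: lerD.
  have h := @sum_convolution_le (fun i => `|p s i - q s i|) (q t)
    (fun=> normr_ge0 _) (fun m => q0 t m t0).
  by apply: le_trans h _; rewrite ler_piMr ?q1// sumr_ge0.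
have h := @sum_convolution_le (p s) (fun i => `|p t i - q t i|)
  (fun m => p0 s m s0) (fun=> normr_ge0 _).
by apply: le_trans h _; rewrite ler_piMl ?p1// sumr_ge0.
Qed.

Let dist_mul t n : 0 <= t -> dist (n.+1%:R * t) <= n.+1%:R * dist t.
Proof.
move=> t0; elim: n => [|n IH]; first by rewrite !mul1r.
rewrite -[n.+2%:R]natr1 !mulrDl !mul1r.
by apply: le_trans (dist_subadd _ _) _ => //; rewrite ?mulr_ge0// lerD2r.
Qed.

(** The total distance between p t and q t is subadditive in t, so at time t it
    is at most n times the distance at time t / n.  When p and q agree up to o(h),
    this bound tends to 0 as n grows. *)
Lemma substochastic_semigroup_unique :
  (forall m e, (m < N)%N -> 0 < e ->
     \forall h \near 0^'+, `|p h m - q h m| <= e * h) ->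
  forall t m, 0 < t -> (m < N)%N -> p t m = q t m.
Proof.
move=> small t m t0 mN.
suff: dist t <= 0.
  move=> d0; apply/eqP; rewrite -subr_eq0 -normr_le0; apply: le_trans d0.
  by rewrite /dist (bigD1 (Ordinal mN))//= lerDl sumr_ge0.
apply/ler_addgt0Pr => e e0; rewrite add0r.
have N0 : 0 < N%:R :> R by rewrite ltr0n (leq_ltn_trans _ mN).
pose e' := e / (N%:R * t); have e'0 : 0 < e' by rewrite divr_gt0// mulr_gt0.
have : \forall h \near 0^'+, dist h <= N%:R * (e' * h).
  have : \forall h \near 0^'+, forall i : 'I_N, `|p h i - q h i| <= e' * h.
    by apply: filter_forall => i; exact: small.
  apply: filterS => h H; rewrite /dist mulr_natl.
  rewrite -[X in _ *+ X]card_ord -sumr_const; exact: ler_sum.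
move=> /nbhs_ballP[r /= r0 H].
pose n := Num.truncn (t / r).
have n0 : 0 < n.+1%:R :> R by [].
have tr : t / n.+1%:R < r by rewrite ltr_pdivrMr// -ltr_pdivrMl// mulrC truncnS_gt.
have tn0 : 0 < t / n.+1%:R by rewrite divr_gt0.
have := H (t / n.+1%:R).
rewrite /ball/= sub0r normrN gtr0_norm// => /(_ tr tn0) H'.
have {1}-> : t = n.+1%:R * (t / n.+1%:R) by rewrite mulrC divfK.
apply: le_trans (dist_mul _ (ltW tn0)) _.
apply: le_trans (ler_wpM2l (ltW n0) H') _.
rewrite le_eqVlt; apply/orP; left; apply/eqP; rewrite /e'.
by field; rewrite !gt_eqF.
Qed.

End convolution_semigroups.

(** * The closed form of the law of a generalized counting process *)

(** Every coordinate of a point of Omega k n is at most n, which turns the sum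
    over a set of functions into one over a finite type. *)
Lemma sum_Omega (V : zmodType) (k N n : nat) (G : {ffun 'I_k -> nat} -> V) :
  (n < N)%N ->
  \sum_(x \in Omega k n) G x =
  \sum_(f : {ffun 'I_k -> 'I_N} | (\sum_(j < k) j.+1 * f j)%N == n)
    G [ffun j => f j : nat].
Proof.
move=> nN.
pose phi (f : {ffun 'I_k -> 'I_N}) : {ffun 'I_k -> nat} := [ffun j => f j : nat].
pose Pn := [pred f : {ffun 'I_k -> 'I_N} | (\sum_(j < k) j.+1 * f j)%N == n].
have phi_inj : injective phi.
  move=> f g /ffunP fg; apply/ffunP => j; apply/val_inj.
  by have := fg j; rewrite !ffunE.
rewrite (@fsbigE _ _ _ _ (Omega k n) [seq phi f | f <- enum Pn]).
- rewrite big_map big_enum_cond/=; apply: eq_bigl => f.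
  rewrite inE; case: eqP => //= fn; apply: mem_set.
  by rewrite /Omega/= -[RHS]fn; apply: eq_bigr => j _; rewrite ffunE.
- by rewrite map_inj_uniq ?enum_uniq.
- move=> x /= /mapP[f]; rewrite mem_enum inE => /eqP fn ->.
  by rewrite /Omega/= -[RHS]fn; apply: eq_bigr => j _; rewrite ffunE.
- move=> x xn /negP[]; apply/mapP.
  have xN j : (x j < N)%N.
    apply: leq_ltn_trans nN; rewrite -xn (bigD1 j)//=.
    by rewrite (leq_trans _ (leq_addr _ _))// mulSn leq_addr.
  exists [ffun j => Ordinal (xN j)].
    rewrite mem_enum inE -xn; apply/eqP; apply: eq_bigr => j _.
    by rewrite ffunE.
  by apply/ffunP => j; rewrite !ffunE.
Qed.

Section gcp_pmf.
Context {R : realType} {k : nat}.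
Variable lambda : 'I_k -> R.
Hypothesis lambda_gt0 : forall j, 0 < lambda j.
Let Lambda := \sum_(j < k) lambda j.
Variable N : nat.

(** The exponential series of x X, truncated at degree N: power series are
    replaced by polynomials whose coefficients below N are correct. *)
Definition texp (x : R) : {poly R} := \poly_(i < N) (x ^+ i / i`!%:R).

Definition gcp_factor (j : 'I_k) (t : R) : {poly R} :=
  texp (lambda j * t) \Po 'X^(j.+1).

(** The probability generating function of M(t), without its factor
    exp(- Lambda t): the numbers of jumps of the different sizes are
    independent Poisson variables. *)
Definition gcp_gf (t : R) : {poly R} := \prod_(j < k) gcp_factor j t.

Definition gcp_pmf (t : R) (m : nat) : R := expR (- Lambda * t) * (gcp_gf t)`_m.

Lemma coef_gcp_factor j t i : (gcp_factor j t)`_i =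
  if (j.+1 %| i)%N then (texp (lambda j * t))`_(i %/ j.+1) else 0.
Proof. exact: coef_comp_poly_Xn. Qed.

Lemma coef_texp_ge0 x i : 0 <= x -> 0 <= (texp x)`_i.
Proof.
move=> x0; rewrite coef_poly; case: ifP => // _.
by rewrite divr_ge0// exprn_ge0.
Qed.

Lemma coef_gcp_gf_ge0 t i : 0 <= t -> 0 <= (gcp_gf t)`_i.
Proof.
move=> t0; rewrite /gcp_gf; elim/big_rec : _ i => [i|j p _ IH i].
  by rewrite coefC; case: ifP.
rewrite coefM sumr_ge0// => l _; rewrite mulr_ge0// coef_gcp_factor.
by case: ifP => // _; rewrite coef_texp_ge0// mulr_ge0// ltW.
Qed.

Lemma texp1_le x : 0 <= x -> (texp x).[1] <= expR x.
Proof.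
move=> x0; rewrite horner_poly.
rewrite (eq_bigr (fun i : 'I_N => exp_coeff x i)); last first.
  by move=> i _; rewrite expr1n mulr1.
rewrite -(big_mkord xpredT (exp_coeff x)) /expR.
apply: (nondecreasing_cvgn_le (u_ := series (exp_coeff x))).
  by apply: nondecreasing_series => i _ _; exact: exp_coeff_ge0.
exact: is_cvg_series_exp_coeff.
Qed.

Lemma gcp_gf1_le t : 0 <= t -> (gcp_gf t).[1] <= expR (Lambda * t).
Proof.
move=> t0; rewrite /gcp_gf horner_prod /Lambda mulr_suml expR_sum.
apply: ler_prod => j _; rewrite /gcp_factor horner_comp hornerXn expr1n.
rewrite texp1_le ?mulr_ge0 ?(ltW (lambda_gt0 _))// andbT.
rewrite horner_poly sumr_ge0// => i _; rewrite expr1n mulr1 divr_ge0//.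
by rewrite exprn_ge0// mulr_ge0// ltW.
Qed.

Let eqmodX (p q : {poly R}) := forall i, (i < N)%N -> p`_i = q`_i.

Let eqmodXM p p' q q' : eqmodX p p' -> eqmodX q q' -> eqmodX (p * q) (p' * q').
Proof.
move=> pp qq i iN; rewrite !coefM; apply: eq_bigr => l _.
rewrite pp ?qq//; first by rewrite (leq_ltn_trans (leq_subr _ _)).
by rewrite (leq_ltn_trans _ iN)// -ltnS.
Qed.

(** The binomial formula. *)
Let texpD x y : eqmodX (texp (x + y)) (texp x * texp y).
Proof.
move=> i iN; rewrite coefM coef_poly iN exprDn mulr_suml.
rewrite [RHS](reindex_inj rev_ord_inj)/=; apply: eq_bigr => l _.
have lN : (l < N)%N by rewrite (leq_ltn_trans _ iN)// -ltnS.
have li : (l <= i)%N by rewrite -ltnS.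
have ilN : (i - l < N)%N by rewrite (leq_ltn_trans _ iN)// leq_subr.
rewrite subSS subKn// !coef_poly ilN lN -mulr_natr.
rewrite -(bin_fact li) !natrM; field.
by rewrite !pnatr_eq0 -!lt0n !fact_gt0 bin_gt0 li.
Qed.

Let gcp_factorD j s t :
  eqmodX (gcp_factor j (s + t)) (gcp_factor j s * gcp_factor j t).
Proof.
move=> i iN; rewrite /gcp_factor -comp_polyM !coef_comp_poly_Xn//.
case: ifP => // _; rewrite mulrDr texpD//.
by rewrite (leq_ltn_trans (leq_div _ _)).
Qed.

Lemma gcp_gfD s t : eqmodX (gcp_gf (s + t)) (gcp_gf s * gcp_gf t).
Proof.
rewrite /gcp_gf -big_split/=.
elim/big_rec2 : _ => // j p q _ pq; apply: eqmodXM => //; exact: gcp_factorD.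
Qed.

Lemma gcp_pmf_semigroup : substochastic_semigroup N gcp_pmf.
Proof.
split.
- by move=> t m t0; rewrite mulr_ge0 ?expR_ge0 ?coef_gcp_gf_ge0.
- move=> t t0; rewrite -mulr_sumr mulNr expRN mulrC ler_pdivrMr ?expR_gt0// mul1r.
  apply: le_trans (gcp_gf1_le t0); apply: sum_coef_le_horner1 => i.
  exact: coef_gcp_gf_ge0.
- move=> s t m s0 t0 mN; rewrite /gcp_pmf gcp_gfD// coefM mulr_sumr.
  apply: eq_bigr => i _.
  by rewrite mulrDr expRD; ring.
Qed.

(** Expanding the product over j of the sums over x_j, the monomials of degree m
    are those indexed by Omega k m. *)
Lemma gcp_pmfE t m : (m < N)%N ->
  gcp_pmf t m = \sum_(x \in Omega k m)
    (\prod_(j < k) (lambda j ^+ x j / (x j)`!%:R)) *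
    (t ^+ (\sum_(j < k) x j)%N * expR (- Lambda * t)).
Proof.
move=> mN; rewrite (sum_Omega _ mN) /gcp_pmf /gcp_gf.
pose c j (i : 'I_N) := (lambda j * t) ^+ i / i`!%:R.
have factE j : gcp_factor j t = \sum_(i < N) c j i *: 'X^(j.+1 * i).
  rewrite /gcp_factor /texp poly_def linear_sum/=; apply: eq_bigr => i _.
  by rewrite comp_polyZ comp_Xn_poly -exprM.
under eq_bigr do rewrite factE.
rewrite bigA_distr_bigA/= coef_sum mulr_sumr [RHS]big_mkcond/=.
apply: eq_bigr => f _; rewrite scaler_prod -expr_sum coefZ coefXn eq_sym.
case: eqP => _; last by rewrite !mulr0.
rewrite mulr1 mulrC mulrA; congr (_ * _).
rewrite expr_sum -big_split/=; apply: eq_bigr => j _.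
by rewrite ffunE /c exprMn mulrAC.
Qed.

Hypothesis N_gt0 : (0 < N)%N.

(** G behaves as 1 + t A up to first order at t = 0, coefficient by coefficient;
    under products the first-order terms A add up. *)
Let small_rates (G : R -> {poly R}) (A : nat -> R) :=
  (forall m, (G 0)`_m = (m == 0%N)%:R) /\
  forall m, (m < N)%N -> is_derive (0 : R) 1 (fun t => (G t)`_m) (A m).

Let small_rates1 : small_rates (fun=> 1) (fun=> 0).
Proof. by split => [m|m _]; rewrite ?coef1//; exact: is_derive_cst. Qed.

Let small_ratesM G H A B : small_rates G A -> small_rates H B ->
  small_rates (fun t => G t * H t) (fun m => A m + B m).
Proof.
move=> [G0 dG] [H0 dH]; split=> [m|m mN].
  rewrite coefM big_ord_recl/= G0 H0 subn0 mul1r big1 ?addr0// => i _.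
  by rewrite G0 mul0r.
have -> : (fun t => (G t * H t)`_m) =
    \sum_(i < m.+1) ((fun t => (G t)`_i) * (fun t => (H t)`_(m - i))).
  by apply/funext => t; rewrite coefM fct_sumE.
have -> : A m + B m = \sum_(i < m.+1)
    ((G 0)`_i *: B (m - i)%N + (H 0)`_(m - i) *: A i).
  rewrite big_split/= [LHS]addrC; congr (_ + _).
    rewrite big_ord_recl/= G0 subn0 scale1r big1 ?addr0// => i _.
    by rewrite G0 scale0r.
  rewrite big_ord_recr/= H0 subnn scale1r big1 ?add0r// => i _.
  by rewrite H0 subn_eq0 leqNgt ltn_ord scale0r.
apply: is_derive_sum => i; apply: is_deriveM.
  by apply: dG; rewrite (leq_ltn_trans _ mN)// -ltnS.
by apply: dH; rewrite (leq_ltn_trans (leq_subr _ _) mN).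
Qed.

Let small_rates_factor j :
  small_rates (gcp_factor j) (fun m => lambda j * (m == j.+1)%:R).
Proof.
have dX l : is_derive (0 : R) 1 (fun t => (lambda j * t) ^+ l / l`!%:R)
    (lambda j * (l == 1%N)%:R).
  have h := is_deriveZ l`!%:R^-1
    (is_deriveX l (is_deriveZ (lambda j) (is_derive_id (0 : R) (1 : R)))).
  have -> : (fun t => (lambda j * t) ^+ l / l`!%:R) =
      l`!%:R^-1 \*: ((lambda j \*: id) ^+ l).
    by apply/funext => t; rewrite exprfctE mulrC.
  apply: (is_derive_eq h).
  rewrite /GRing.scale/= !mulr1 scaler0.
  case: l {h} => [|[|l]]; first by rewrite !mul0r !mulr0.
    by rewrite invr1 expr0 !mul1r mulr1.
  by rewrite exprS !mul0r !mulr0 mul0r !mulr0.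
split=> [m|m mN].
  rewrite coef_gcp_factor mulr0 coef_poly.
  case: (posnP m) => [->|m0]; first by rewrite dvdn0 div0n N_gt0 expr0 divr1.
  case: ifP => // jm; case: ifP => // _.
  by rewrite expr0n gtn_eqF ?mul0r// divn_gt0// dvdn_leq.
under eq_fun do rewrite coef_gcp_factor coef_poly (leq_ltn_trans (leq_div _ _) mN).
case: dvdnP => [[l ->]|nd]; last first.
  rewrite (_ : m == j.+1 = false) ?mulr0; first exact: is_derive_cst.
  by apply/eqP => mj; apply: nd; exists 1%N; rewrite mul1n.
rewrite mulnK// -[X in _ == X]mul1n eqn_mul2r/=.
exact: dX.
Qed.

Let small_rates_gcp_gf :
  small_rates gcp_gf (fun m => \sum_(j < k) lambda j * (m == j.+1)%:R).
Proof.
rewrite /gcp_gf.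
have : small_rates (fun t => \prod_(j <- index_enum 'I_k) gcp_factor j t)
    (fun m => \sum_(j <- index_enum 'I_k) lambda j * (m == j.+1)%:R).
  elim: (index_enum _) => [|j r IH].
    under eq_fun do rewrite big_nil.
    by under [X in small_rates _ X]eq_fun do rewrite big_nil.
  under eq_fun do rewrite big_cons.
  under [X in small_rates _ X]eq_fun do rewrite big_cons.
  exact: small_ratesM.
by [].
Qed.

Lemma gcp_pmf0 m : gcp_pmf 0 m = (m == 0%N)%:R.
Proof.
by have [G0 _] := small_rates_gcp_gf; rewrite /gcp_pmf mulr0 expR0 mul1r G0.
Qed.

Lemma is_derive_gcp_pmf m : (m < N)%N ->
  is_derive (0 : R) 1 (gcp_pmf ^~ m)
    (\sum_(j < k) lambda j * (m == j.+1)%:R - Lambda * (m == 0%N)%:R).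
Proof.
move=> mN; have [G0 dG] := small_rates_gcp_gf.
have := is_deriveM (is_derive_expRM (- Lambda) 0) (dG _ mN).
rewrite mulr0 expR0 G0 mulr1 scale1r => h.
apply: (is_derive_eq h).
by rewrite /GRing.scale/=; ring.
Qed.

End gcp_pmf.

Lemma continuous_gcp_pmf (R : realType) (k : nat) (lambda : 'I_k -> R) N m :
  (m < N)%N -> continuous (fun t => gcp_pmf lambda N t m).
Proof.
move=> mN.
under eq_fun do rewrite gcp_pmfE// (sum_Omega _ mN).
move=> t.
apply: (@cvg_big R^o _ +%R 0) => [|f _]; first exact: add_continuous.
apply: cvgM; first exact: cvg_cst.
apply: cvgM; first exact: exprn_continuous.
exact: (@continuous_comp _ _ _ _ expR t (@mulrl_continuous _ _ t) (@continuous_expR _ _)).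
Qed.

(** * The law of a generalized counting process *)

Lemma is_derive_small_right (R : realType) (f : R -> R) (a e : R) :
  is_derive (0 : R) 1 f a -> 0 < e ->
  \forall h \near 0^'+, `|f h - (f 0 + a * h)| <= e * h.
Proof.
move=> [df fa] e0.
have : h^-1 *: (f (h *: 1 + 0) - f 0) @[h --> 0^'] --> a.
  by rewrite -fa; exact: df.
move=> /cvgrPdist_le/(_ _ e0) H.
rewrite /at_right near_withinE.
move: H; rewrite /dnbhs near_withinE; apply: filterS => h H h0.
have := H (lt0r_neq0 h0); rewrite addr0 /GRing.scale/= mulr1 => ah.
rewrite opprD addrA distrC -(ler_pM2l (_ : 0 < h^-1)) ?invr_gt0//.
rewrite -[X in X * _](gtr0_norm (_ : 0 < h^-1)) ?invr_gt0// -normrM.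
rewrite mulrCA mulVf ?gt_eqF// mulr1 mulrBr mulrC -[a * h * _]mulrA mulfV ?gt_eqF// mulr1.
exact: ah.
Qed.

Section gcp_marginals.
Context {d : measure_display} {T : measurableType d} {R : realType}.
Variables (P : probability T R) (k : nat) (lambda : 'I_k -> R).
Hypothesis lambda_gt0 : forall j, 0 < lambda j.
Variable M : R -> T -> nat.
Hypothesis hM : generalized_counting_process P lambda M.
Let Lambda := \sum_(j < k) lambda j.

Let levyM : levy_process P (nat_process M) := gcp_levy hM.

Lemma measurable_gcp_eq t m : 0 <= t -> measurable [set w | M t w = m].
Proof.
move=> t0; have := levy_measurable levyM t0 measurableT (measurable_set1 (m%:R : R)).
rewrite setTI; congr measurable; apply/seteqP; split => w /=; rewrite /nat_process.
  by move=> /(@mulrIn R 1 (oner_neq0 R)).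
by move=> ->.
Qed.

Definition marginal (t : R) (m : nat) : R := fine (P [set w | M t w = m]).

Lemma marginalE t m : 0 <= t -> (marginal t m)%:E = P [set w | M t w = m].
Proof.
by move=> t0; rewrite /marginal fineK// fin_num_measure//; exact: measurable_gcp_eq.
Qed.

Lemma marginal_ge0 t m : 0 <= marginal t m.
Proof. by rewrite /marginal fine_ge0. Qed.

Let M0 w : M 0 w = 0%N.
Proof.
have := levy_start levyM w; rewrite /nat_process => /(@mulrIn R 1 (oner_neq0 R) _ 0%N).
exact.
Qed.

Lemma marginal_sum_le1 t N : 0 <= t -> \sum_(m < N) marginal t m <= 1.
Proof.
move=> t0; rewrite -lee_fin -sumEFin.
under eq_bigr do rewrite marginalE//.
rewrite -measure_bigsetU_ord//.
- apply: probability_le1; apply: bigsetU_measurable => i _; exact: measurable_gcp_eq.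
- by move=> i; exact: measurable_gcp_eq.
- by move=> i j _ _ [w [/= wi wj]]; apply/val_inj; rewrite /= -wi -wj.
Qed.

(** The increment has the law of M t, which is nonnegative. *)
Let increment_lt0 s t : 0 <= s -> 0 <= t ->
  P [set w | (M (s + t) w < M s w)%N] = 0%E.
Proof.
move=> s0 t0.
have := levy_stationary levyM s0 t0 (measurable_itv `]-oo, (0:R)[).
rewrite (_ : [set w | _] = [set w | (M (s + t) w < M s w)%N]).
  move=> ->; rewrite (_ : [set w | _] = set0) ?measure0//.
  by apply/seteqP; split => w //=; rewrite in_itv/= /nat_process ltNge ler0n.
by apply/seteqP; split => w /=; rewrite in_itv/= /nat_process subr_lt0 ltr_nat.
Qed.

Let independent_increment s t i m : 0 <= s -> 0 <= t -> (i <= m)%N ->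
  (P [set w | M s w = i /\ M (s + t) w = m] =
   P [set w | M s w = i] * P [set w | M t w = (m - i)%N])%E.
Proof.
move=> s0 t0 im.
(* Two increments, over [0, s] and [s, s + t]. *)
pose tau (l : nat) := if l is l'.+1 then if l' is _.+1 then s + t else s else 0.
have tau_nd : nondecreasing_seq tau.
  by apply/nondecreasing_seqP => -[|[|l]] //=; rewrite ?lerDl.
pose A (l : 'I_2) : set R := if l == ord0 then [set i%:R] else [set (m - i)%:R].
have mA l : measurable (A l) by rewrite /A; case: ifP => _; exact: measurable_set1.
have := levy_independent levyM (lexx _ : 0 <= tau 0%N) tau_nd mA.
rewrite big_ord_recl big_ord1/=.
have -> : P ((fun w => nat_process M s w - nat_process M 0 w) @^-1` A ord0) =
    P [set w | M s w = i].
  congr (P _); apply/seteqP; split => w /=; rewrite /A eqxx /nat_process M0 subr0/=.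
    by move=> /(@mulrIn R 1 (oner_neq0 R)).
  by move=> ->.
have := levy_stationary levyM s0 t0 (mA (lift ord0 ord0)).
rewrite /A/= => ->.
have -> : P [set w | nat_process M t w = (m - i)%:R] =
    P [set w | M t w = (m - i)%N].
  congr (P _); apply/seteqP; split => w /=; rewrite /nat_process.
    by move=> /(@mulrIn R 1 (oner_neq0 R)).
  by move=> ->.
move=> <-; congr (P _); apply/seteqP; split => w /=.
  move=> [Mi Mm] l _; rewrite /= /nat_process.
  case: l => -[|[|//]] l2 /=; first by rewrite M0 subr0 Mi.
  by rewrite Mm Mi natrB.
move=> H; have /= := H ord0 I; rewrite /nat_process M0 subr0.
move=> /(@mulrIn R 1 (oner_neq0 R)) Mi.
have /= := H (lift ord0 ord0) I; rewrite /nat_process/= Mi natrB//.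
by move=> /subIr/(@mulrIn R 1 (oner_neq0 R)).
Qed.

(** Decompose according to the value i of M s; the values i > m contribute
    nothing, since decreasing is a null event. *)
Lemma marginal_convolution s t m : 0 <= s -> 0 <= t ->
  marginal (s + t) m = \sum_(i < m.+1) marginal s i * marginal t (m - i)%N.
Proof.
move=> s0 t0; apply: EFin_inj; have st0 := addr_ge0 s0 t0.
rewrite marginalE// -sumEFin.
under eq_bigr => i _.
  rewrite EFinM !marginalE// -independent_increment//; last by rewrite -ltnS.
  over.
have mE i : measurable [set w | M s w = i /\ M (s + t) w = m].
  by apply: measurableI; exact: measurable_gcp_eq.
rewrite -measure_bigsetU_ord//; last first.
  by move=> i j _ _ [w [/= [wi _] [wj _]]]; apply/val_inj; rewrite /= -wi -wj.
pose E i := [set w | M s w = i /\ M (s + t) w = m].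
pose B := [set w | (M (s + t) w < M s w)%N].
have mB : measurable B.
  have := measurable_fun_ltr (levy_measurable levyM st0) (levy_measurable levyM s0).
  move=> /(_ measurableT [set true] _); rewrite setTI => H.
  have /H : measurable [set true] by [].
  by congr measurable; apply/seteqP; split => w /=; rewrite /nat_process /B/= ltr_nat.
apply/eqP; rewrite eq_le; apply/andP; split.
  rewrite -[leRHS](measureU0 _ mB (increment_lt0 s0 t0)); last first.
    by apply: bigsetU_measurable => i _; exact: mE.
  apply: le_measure; rewrite ?inE.
  - exact: measurable_gcp_eq.
  - by apply: measurableU => //; apply: bigsetU_measurable => i _; exact: mE.
  move=> w /= Mm; have [le|lt] := leqP (M s w) m; last by right; rewrite /B/= Mm.
  by left; rewrite -(bigcup_mkord m.+1 E); exists (M s w).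
apply: le_measure; rewrite ?inE.
- by apply: bigsetU_measurable => i _; exact: mE.
- exact: measurable_gcp_eq.
by rewrite -(bigcup_mkord m.+1 E) => w [i /= _ [_]].
Qed.

(** Both families are convolution semigroups, and near time 0 they agree up to
    o(h): the transition probabilities out of the state 0 at time 0 are the
    marginals themselves. *)
Lemma gcp_marginal t n : 0 < t -> marginal t n = gcp_pmf lambda n.+1 t n.
Proof.
move=> t0; apply: (@substochastic_semigroup_unique _ n.+1) => //.
- split.
  + by move=> s m _; exact: marginal_ge0.
  + by move=> s s0; exact: marginal_sum_le1.
  + by move=> s u m s0 u0 _; exact: marginal_convolution.
- exact: gcp_pmf_semigroup.
move=> m e mn e0.
have e20 : 0 < e / 2 by rewrite divr_gt0.
pose a : R := \sum_(j < k) lambda j * (m == j.+1)%:R - Lambda * (m == 0%N)%:R.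
have Hq : \forall h \near 0^'+,
    `|gcp_pmf lambda n.+1 h m - ((m == 0%N)%:R + a * h)| <= e / 2 * h.
  rewrite -(gcp_pmf0 lambda (ltn0Sn n) m).
  exact: is_derive_small_right (is_derive_gcp_pmf lambda (ltn0Sn n) mn) e20.
suff Hp : \forall h \near 0^'+, `|marginal h m - ((m == 0%N)%:R + a * h)| <= e / 2 * h.
  apply: filterS2 Hq Hp => h h1 h2.
  have -> : marginal h m - gcp_pmf lambda n.+1 h m =
    (marginal h m - ((m == 0%N)%:R + a * h)) -
    (gcp_pmf lambda n.+1 h m - ((m == 0%N)%:R + a * h)) by ring.
  by apply: le_trans (ler_normB _ _) _; lra.
have P0 : (0 < P [set w | M 0 w = 0%N])%E.
  rewrite (_ : [set w | _] = setT); last by apply/seteqP; split => w //=.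
  have := probability_setT P; rewrite /= => ->; exact: lte01.
have tE j h : transition_prob P M 0 0 j h = marginal h j.
  rewrite /transition_prob /cond_prob add0r.
  rewrite (_ : [set w | M 0 w = 0%N] = setT); last by apply/seteqP; split => w //=.
  have := probability_setT P; rewrite /= => ->; rewrite divr1 setIT.
  by congr (fine (P _)); apply/seteqP; split => w /=; rewrite add0n.
have right_pos : \forall h \near (0 : R)^'+, 0 < h by exact: nbhs_right_gt.
have [m0|m0] := posnP m.
  have /eqaddoP/(_ _ e20) := gcp_nojump hM (lexx 0) P0.
  apply: filterS2 right_pos => h h0; rewrite /= !fctE tE (gtr0_norm h0).
  rewrite (_ : a = - Lambda); first by rewrite m0 mulNr.
  by rewrite /a m0 mulr1 big1 ?add0r// => j _; rewrite mulr0.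
have [mk|km] := leqP m k; last first.
  have /eqoP/(_ _ e20) := gcp_other hM (lexx 0) P0 km.
  apply: filterS2 right_pos => h h0; rewrite /= tE (gtr0_norm h0).
  rewrite (_ : a = 0) ?mul0r ?addr0; first by rewrite mulr0n subr0.
  rewrite /a gtn_eqF// mulr0 subr0 big1// => j _.
  by rewrite gtn_eqF ?mulr0// (leq_ltn_trans _ km).
have mk' : (m.-1 < k)%N by rewrite prednK.
have /eqaddoP/(_ _ e20) := gcp_jump hM (lexx 0) P0 (Ordinal mk').
apply: filterS2 right_pos => h h0; rewrite /= !fctE prednK// tE (gtr0_norm h0).
rewrite mulr0n add0r (_ : a = lambda (Ordinal mk'))//.
rewrite /a gtn_eqF// mulr0 subr0 (bigD1 (Ordinal mk'))//= prednK// eqxx mulr1.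
rewrite big1 ?addr0// => j jm; rewrite (_ : m == j.+1 = false) ?mulr0//.
apply/negbTE; apply: contra jm => /eqP mj; apply/eqP/val_inj.
by rewrite /= mj.
Qed.

End gcp_marginals.

(** * Counting processes at random independent times *)

Section upper_grid.
Context {R : realType}.

Definition grid_index (m : nat) (x : R) : nat := Num.truncn (m.+1%:R * x).

(** The grid point strictly above x, so that the limit is taken from the right
    even when x is itself on the grid. *)
Definition grid_above (m : nat) (x : R) : R := (grid_index m x).+1%:R / m.+1%:R.

Lemma grid_above_gt m x : x < grid_above m x.
Proof. by rewrite ltr_pdivlMr// mulrC truncnS_gt. Qed.

Lemma grid_above_le m x : 0 <= x -> grid_above m x <= x + m.+1%:R^-1.
Proof.
move=> x0; rewrite ler_pdivrMr// mulrDl mulVf// -natr1 lerD2r mulrC.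
by rewrite truncn_le mulr_ge0.
Qed.

Lemma grid_above_cvg x : 0 <= x -> grid_above m x @[m --> \oo] --> x^'+.
Proof.
move=> x0.
have c : grid_above m x @[m --> \oo] --> x.
  have h : x + m.+1%:R^-1 @[m --> \oo] --> x + 0.
    by apply: cvgD; [exact: cvg_cst|exact: cvg_harmonic].
  rewrite addr0 in h.
  apply: (@squeeze_cvgr _ _ _ _ (fun=> x) _ _ _ _ _ h); last exact: cvg_cst.
  by apply: nearW => m; rewrite grid_above_le// ltW// grid_above_gt.
move=> A /= xA.
have := c _ xA; rewrite !near_simpl.
by apply: filterS => m; apply; exact: grid_above_gt.
Qed.

Lemma measurable_grid_above m : measurable_fun setT (grid_above m).
Proof.
apply: nondecreasing_measurable => // x z xz; rewrite ler_pM2r ?invr_gt0//.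
by rewrite ler_nat ltnS le_truncn// ler_wpM2l.
Qed.

End upper_grid.

Section random_time.
Context {d : measure_display} {T : measurableType d} {R : realType}.
Variables (P : probability T R) (M : R -> T -> nat) (y : T -> R) (n : nat).
Variable q : R -> R.
Hypothesis mM : forall t, 0 <= t -> measurable [set w | M t w = n].
Hypothesis M_rc : forall t w, 0 <= t ->
  nat_process M s w @[s --> t^'+] --> nat_process M t w.
Hypothesis my : measurable_fun setT y.
Hypothesis y0 : forall w, 0 <= y w.
Hypothesis Pq : forall t, 0 < t -> P [set w | M t w = n] = (q t)%:E.
Hypothesis q_cont : continuous q.
Hypothesis q_itv : forall t, 0 <= t -> 0 <= q t <= 1.
Hypothesis My : forall t C, 0 <= t -> measurable C ->
  (P ([set w | M t w = n] `&` y @^-1` C) =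
   P [set w | M t w = n] * P (y @^-1` C))%E.

Let B m i := [set w | grid_index m (y w) = i].

Let BE m i : B m i = y @^-1` [set x | 0 <= x /\ grid_index m x = i].
Proof. by apply/seteqP; split => w /= => [|[]]. Qed.

Let mgrid m i : measurable [set x : R | 0 <= x /\ grid_index m x = i].
Proof.
suff -> : [set x : R | 0 <= x /\ grid_index m x = i] =
    `[i%:R / m.+1%:R, i.+1%:R / m.+1%:R[%classic by exact: measurable_itv.
apply/seteqP; split => x /=; rewrite in_itv/= ler_pdivrMr// ltr_pdivlMr//.
  move=> [x0 /eqP]; rewrite /grid_index truncn_eq ?mulr_ge0// [x * _]mulrC.
  exact.
rewrite mulrC => h; have /andP[h1 _] := h.
have x0 : 0 <= x by rewrite -(pmulr_rge0 _ (ltr0Sn R m)); apply: le_trans h1.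
by split => //; apply/eqP; rewrite truncn_eq// mulr_ge0.
Qed.

Let mB m i : measurable (B m i).
Proof. by rewrite BE -[X in measurable X]setTI; exact: my. Qed.

Let B_triv m : trivIset setT (B m).
Proof. by move=> i j _ _ [w [/= <- <-]]. Qed.

Let B_cover m : \bigcup_i B m i = setT.
Proof. by apply/seteqP; split => w // _; exists (grid_index m (y w)). Qed.

Let A m := [set w | M (grid_above m (y w)) w = n].

Let time m i : R := i.+1%:R / m.+1%:R.

Let AB m i : A m `&` B m i = [set w | M (time m i) w = n] `&` B m i.
Proof.
by apply/seteqP; split => w [/= + Bw]; rewrite /A/= /grid_above Bw.
Qed.

Let time_gt0 m i : 0 < time m i. Proof. by rewrite divr_gt0. Qed.

Let mAB m i : measurable (A m `&` B m i).
Proof. by rewrite AB; apply: measurableI => //; apply: mM; exact: ltW. Qed.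

Let AE m : A m = \bigcup_i (A m `&` B m i).
Proof. by rewrite -setI_bigcupr B_cover setIT. Qed.

Let mA m : measurable (A m).
Proof. by rewrite AE; exact: bigcupT_measurable. Qed.

Let mq m : measurable_fun setT (fun w => q (grid_above m (y w))).
Proof.
apply: (measurableT_comp (continuous_measurable_fun q_cont)).
by apply: (measurableT_comp (measurable_grid_above m)).
Qed.

Let grid_above_ge0 m (x : R) : 0 <= grid_above m x.
Proof. by rewrite divr_ge0. Qed.

(** The approximating time has countably many values; on each of the events B m i
    it is deterministic and independence applies. *)
Let P_grid m : P (A m) = (\int[P]_w (q (grid_above m (y w)))%:E)%E.
Proof.
rewrite AE measure_semi_bigcup//; last 2 first.
  by move=> i j _ _ [w [[_ Bi] [_ Bj]]]; apply: (@B_triv m) => //; exists w.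
  by rewrite -AE.
have -> : (\int[P]_w (q (grid_above m (y w)))%:E =
    \int[P]_(w in \bigcup_i B m i) (q (grid_above m (y w)))%:E)%E.
  by rewrite B_cover.
rewrite ge0_integral_bigcup//.
- apply: eq_eseriesr => i _; rewrite AB BE.
  transitivity (P [set w | M (time m i) w = n] *
      P (y @^-1` [set x | (0 <= x)%R /\ grid_index m x = i]))%E.
    by apply: My => //; exact: ltW.
  rewrite Pq// -BE -[RHS](_ : \int[P]_(w in B m i) (q (time m i))%:E = _)%E.
    by rewrite integral_cst.
  by apply: eq_integral => w; rewrite inE => Bw; rewrite /grid_above Bw.
- rewrite B_cover; apply/measurable_EFinP; exact: mq.
- by move=> w _; rewrite lee_fin; have /andP[] := q_itv (grid_above_ge0 m (y w)).
Qed.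

(** A right-continuous path with integer values is locally constant to the
    right. *)
Let A_cvg w : \1_(A m) w @[m --> \oo] --> (\1_[set w | M (y w) w = n] w : R).
Proof.
apply: (@cvg_near_cst nat R^o _ (fun m => \1_(A m) w) \oo).
have /cvgrPdist_lt/(_ _ ltr01) H := @M_rc _ w (y0 w).
have := grid_above_cvg (y0 w) H; rewrite !near_simpl.
apply: filterS => m; rewrite /nat_process !indicE => Mm.
suff -> : (w \in A m) = (w \in [set w | M (y w) w = n]) by [].
have {}Mm : M (grid_above m (y w)) w = M (y w) w.
  apply/eqP; rewrite eq_sym eqn_leq -!(ler_nat R).
  have close (a b : nat) : `|a%:R - b%:R : R| < 1 -> (a <= b)%N.
    rewrite ltr_norml => /andP[_]; rewrite ltrBlDl natr1 ltr_nat.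
    by rewrite ltnS.
  rewrite !ler_nat; apply/andP; split; apply: close => //.
  by rewrite distrC.
by apply/idP/idP; rewrite !inE /A/= Mm.
Qed.

(** Dominated convergence on both sides of the identity on the grid. *)
Lemma random_time_marginal :
  P [set w | M (y w) w = n] = (\int[P]_w q (y w))%:E.
Proof.
have mI m : measurable_fun setT (\1_(A m) : T -> R) by exact: measurable_indic.
have mIlim : measurable_fun setT (\1_[set w | M (y w) w = n] : T -> R).
  by apply: measurable_fun_cvg mI _ => w _; exact: A_cvg.
have mlim : measurable [set w | M (y w) w = n].
  have := mIlim measurableT _ (measurable_set1 1).
  rewrite setTI; congr measurable; apply/seteqP; split => w /=; rewrite indicE.
    by case: (boolP (w \in _)) => [/set_mem//|_ /esym/eqP]; rewrite oner_eq0.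
  by move=> Mw; rewrite mem_set.
have i1 : P.-integrable setT (EFin \o cst (1 : R)).
  exact: finite_measure_integrable_cst.
have [||||||_ h1] := @dominated_cvg_Rintegral _ _ _ P setT
  (fun m => \1_(A m)) (\1_[set w | M (y w) w = n]) (cst 1) => //.
- by apply: aeW => w _; exact: A_cvg.
- by move=> m w _; rewrite indicE; case: (_ \in _); rewrite ?normr1 ?normr0.
have [||||||_ h2] := @dominated_cvg_Rintegral _ _ _ P setT
  (fun m w => q (grid_above m (y w))) (fun w => q (y w)) (cst 1) => //.
- exact: (measurableT_comp (continuous_measurable_fun q_cont)).
- apply: aeW => w _; apply: (cvg_comp _ _ (grid_above_cvg (y0 w))).
  by apply: cvg_at_right_filter; exact: q_cont.
- move=> m w _; have /andP[? ?] := q_itv (grid_above_ge0 m (y w)).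
  by rewrite ger0_norm.
have E : (fun m => \int[P]_w \1_(A m) w) = (fun m => \int[P]_w q (grid_above m (y w))).
  by apply/funext => m; rewrite Rintegral_indic_prob// P_grid.
rewrite E in h1.
have := cvg_unique _ h1 h2; rewrite Rintegral_indic_prob// => /(_ (@Rhausdorff R)) <-.
by rewrite fineK// fin_num_measure.
Qed.

End random_time.

(** * The fractional process *)

Section poisson_mixture.
Context {d : measure_display} {T : measurableType d} {R : realType}.
Variables (P : probability T R) (Y : T -> R).
Hypothesis mY : measurable_fun setT Y.
Hypothesis Y0 : forall w, 0 <= Y w.
Variables (k : nat) (lambda : 'I_k -> R).
Let Lambda := \sum_(j < k) lambda j.
Hypothesis Lambda_gt0 : 0 < Lambda.

Lemma Rintegral_gcp_pmf n :
  \int[P]_w gcp_pmf lambda n.+1 (Y w) n =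
  \sum_(x \in Omega k n) (\prod_(j < k) (lambda j ^+ x j / (x j)`!%:R)) *
    exp_moment P Y (\sum_(j < k) x j)%N Lambda.
Proof.
have nn : (n < n.+1)%N by [].
under eq_Rintegral do rewrite gcp_pmfE// (sum_Omega _ nn) big_mkcond/=.
rewrite (sum_Omega _ nn).
pose phi (f : {ffun 'I_k -> 'I_n.+1}) : {ffun 'I_k -> nat} :=
  [ffun j => f j : nat].
pose c (f : {ffun 'I_k -> 'I_n.+1}) : R :=
  if (\sum_(j < k) j.+1 * f j)%N == n then
    \prod_(j < k) (lambda j ^+ phi f j / (phi f j)`!%:R) else 0.
pose z (f : {ffun 'I_k -> 'I_n.+1}) := (\sum_(j < k) phi f j)%N.
transitivity (\int[P]_w \sum_(f : {ffun 'I_k -> 'I_n.+1})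
    c f * (Y w ^+ z f * expR (- Lambda * Y w))).
  apply: eq_Rintegral => w _; apply: eq_bigr => f _.
  by rewrite /c; case: ifP => // _; rewrite mul0r.
have im f := integrable_exp_moment P mY Y0 (z f) Lambda_gt0.
rewrite Rintegral_sum//; last first.
  by move=> f; have := integrable_scale (c f) measurableT (im f).
rewrite [RHS]big_mkcond; apply: eq_bigr => f _; rewrite RintegralZl//.
by rewrite /c; case: ifP => // _; rewrite mul0r.
Qed.

End poisson_mixture.

Section fractional_time_change.
Context {d : measure_display} {T : measurableType d} {R : realType}.
Variables (P : probability T R) (k : nat) (lambda : 'I_k -> R) (beta : R).
Hypothesis lambda_gt0 : forall j, 0 < lambda j.
Hypothesis beta_gt0 : 0 < beta.
Variables (M : R -> T -> nat) (D : R -> T -> R).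
Hypothesis hM : generalized_counting_process P lambda M.
Hypothesis hD : stable_subordinator P beta D.
Hypothesis MD : independent_processes P (nat_process M) (inverse_process D).

Lemma time_change_marginal n t : 0 <= t ->
  P [set w | time_change M (inverse_process D) t w = n] =
  (\int[P]_w gcp_pmf lambda n.+1 (inverse_process D t w) n)%:E.
Proof.
move=> t0; have [q0 q1 _] := gcp_pmf_semigroup lambda_gt0 n.+1.
apply: (@random_time_marginal _ _ _ P M (inverse_process D t) n
  (fun s => gcp_pmf lambda n.+1 s n)).
- by move=> s s0; exact: measurable_gcp_eq hM _ _ s0.
- by move=> s w s0; exact: levy_right_continuous (gcp_levy hM) _ _ s0.
- exact: (measurable_inverse_stable hD).
- exact: inverse_process_ge0.
- by move=> s s0; rewrite -(marginalE hM) ?ltW// (gcp_marginal lambda_gt0 hM).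
- exact: continuous_gcp_pmf.
- move=> s s0; rewrite q0//=; apply: le_trans (q1 s s0).
  by rewrite big_ord_recr/= lerDr sumr_ge0// => i _; exact: q0.
- move=> s C s0 mC; apply: MD; apply: sub_sigma_algebra.
    exists s, [set n%:R]; split => //.
    apply/seteqP; split => w /=; rewrite /nat_process; first by move=> ->.
    by move/(@mulrIn R 1 (oner_neq0 R)).
  by exists t, C.
Qed.

(** On s > 0 the Mittag-Leffler function is the Laplace transform of the inverse
    subordinator at Lambda / s, whose derivatives are exponential moments. *)
Lemma derive1n_mittag_leffler_stable z t (Lambda : R) : 0 < t -> 0 < Lambda ->
  derive1n z (fun s : R => s ^ (z%:Z - 1) *
    mittag_leffler beta 1 (- (Lambda * t `^ beta / s))) 1 =
  Lambda ^+ z * exp_moment P (inverse_process D t) z Lambda.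
Proof.
move=> t0 L0.
have mY := measurable_inverse_stable hD t.
have Y0 := inverse_process_ge0 D t.
have dF m (u : R) : 0 < u -> is_derive u 1 (exp_moment P (inverse_process D t) m)
    (- exp_moment P (inverse_process D t) m.+1 u).
  exact: is_derive_exp_moment.
rewrite -(derive1n_reciprocal_at1 dF)//.
apply: eq_derive1n_gt0 => // s s0; congr (_ * _).
rewrite mulrAC -(inverse_stable_laplace beta_gt0 hD) ?divr_gt0//.
by apply: eq_Rintegral => w _; rewrite expr0 mul1r.
Qed.

End fractional_time_change.

Theorem proposition3p1 (d : measure_display) (T : measurableType d)
    (R : realType) (P : probability T R)
    (k : nat) (k_ge1 : (1 <= k)%N)
    (lambda : 'I_k -> R) (lambda_gt0 : forall j, 0 < lambda j)
    (beta : R) (beta_gt0 : 0 < beta) (beta_lt1 : beta < 1)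
    (Mbeta : R -> T -> nat)
    (Mbeta_gfcp : generalized_fractional_counting_process P lambda beta Mbeta)
    (n : nat) (t : R) (t_gt0 : 0 < t) :
  let Lambda := \sum_(j < k) lambda j in
  P [set w | Mbeta t w = n] =
  (\sum_(x \in Omega k n)
     let z := (\sum_(j < k) x j)%N in
     (\prod_(j < k) (lambda j ^+ x j / (x j)`!%:R)) * (1 / Lambda ^+ z) *
     derive1n z (fun s : R => s ^ (z%:Z - 1) *
       mittag_leffler beta 1 (- (Lambda * t `^ beta / s))) 1)%:E.
Proof.
move=> Lambda.
have Lambda_gt0 : 0 < Lambda.
  rewrite /Lambda (bigD1 (Ordinal k_ge1))//= ltr_wpDr// sumr_ge0// => j _.
  exact: ltW.
have [M [D [hM hD MD MbetaE]]] := Mbeta_gfcp.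
have mY := measurable_inverse_stable hD t.
have Y0 := inverse_process_ge0 D t.
rewrite MbetaE ?(ltW t_gt0)// (time_change_marginal lambda_gt0 hM hD MD) ?(ltW t_gt0)//.
rewrite Rintegral_gcp_pmf//; congr (_%:E); apply: eq_fsbigr => x _ /=.
rewrite (derive1n_mittag_leffler_stable beta_gt0 hD)//.
by rewrite mulrA -(mulrA (\prod_j _)) div1r mulVf ?mulr1// expf_neq0// gt_eqF.
Qed.
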